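(* Assume that $\mathrm S$ and $\mathbb U$ are compact, that $\lambda>\frac N2\operatorname{diam}(\mathrm S,\|\cdot\|_2)^2$, that the state quantization is done with balls of radius $\frac1n$, and that the measure quantization index $\ell$ is a function of $n$ of order $\mathcal O(n^{d+1})$. Then there exists a family of nonnegative real numbers $(\varepsilon^{(\ell,n,m)})_{\ell,n,m\in\mathbb N}$ with $$\varepsilon^{(\ell,n,m)}\to0\quad\text{as }\ell,n,m\to\infty,$$ such that for all $\ell,n,m\in\mathbb N$ and all optimal controls $\underline U^{(\ell,n,m)*}\in\mathbb U_m^T$ for $\mathsf{MDP}^{(\ell,n,m)}$, $$V(\underline U^{(\ell,n,m)*})\le\inf_{\underline\gamma\in\Gamma}V(\underline\gamma)+\varepsilon^{(\ell,n,m)}.$$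
   Context: Fix integers $N,K,d,d_1,d_2,T\ge1$, $\beta>0$, $\lambda>0$. Let $\mathrm S\subset\mathbb R^d$ (nonempty), $p_i:=i/N$, $\mathrm{PE}_N:=\{p_1,\dots,p_N\}$, $\mathbb X:=\mathrm{PE}_N\times\mathrm S$. Let $\sigma:\mathbb R^{d_1}\to\mathbb R^{d_1}$ be an activation function (usually taken to be a nonlinear $1$-Lipschitz function, for example the componentwise ReLU). The action space $\mathbb U$ is a nonempty set of tuples $U=(\mathsf W,\mathsf A,\mathsf b,\mathsf Q,\mathsf K,\mathsf V)$ with $\mathsf W\in\mathbb R^{d\times d_1}$, $\mathsf A\in\mathbb R^{d_1\times d}$, $\mathsf b\in\mathbb R^{d_1}$, $\mathsf Q,\mathsf K\in\mathbb R^{d_2\times d}$, $\mathsf V\in\mathbb R^{d\times d}$, with the product Frobenius norm $\|\cdot\|_{\mathbb U}$. $\mathcal P(\Omega)$ denotes the Borel probability measures on $\Omega$, with the topology of weak convergence. For $\mu\in\mathcal P(\mathbb X)$, $\mu_{\mathrm S}$ is its marginal on $\mathrm S$. Define $f:\mathbb X\times\mathbb U\times\mathcal P(\mathbb X)\to\mathbb X$ by $$f((p,x),U,\mu):=\Big(p,\ \mathsf W\sigma(\mathsf Ax+\mathsf b)+\frac{\int_{\mathrm S}e^{\beta\langle\mathsf Qx,\mathsf Kz\rangle}\mathsf Vz\,\mu_{\mathrm S}(dz)}{\int_{\mathrm S}e^{\beta\langle\mathsf Qx,\mathsf Kz\rangle}\mu_{\mathrm S}(dz)}\Big)$$ ($f$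 is taken to be $\mathbb X$-valued). Let $\Phi(\mu,U):=\mu\circ f(\cdot,U,\mu)^{-1}$ (push-forward). $W_{2,\lambda}(P,Q):=\big(\inf_\pi\int(\|x-y\|_2^2+\lambda|p-q|^2)\,\pi(d(p,x),d(q,y))\big)^{1/2}$, the infimum being over couplings $\pi$ of $P,Q\in\mathcal P(\mathbb X)$. $\operatorname{diam}(\mathrm S,\|\cdot\|_2):=\sup_{x,y\in\mathrm S}\|x-y\|_2$. Data: $(\mathbf x^k,\mathbf y^k)\in\mathrm S^N\times\mathrm S^N$, $k=1,\dots,K$, with $\mathbf x^k=(x^{1,k},\dots,x^{N,k})$, $\mathbf y^k=(y^{1,k},\dots,y^{N,k})$; put $\mu_0^k:=\frac1N\sum_{i=1}^N\delta_{(p_i,x^{i,k})}$, $\nu^k:=\frac1N\sum_{i=1}^N\delta_{(p_i,y^{i,k})}$. Original problem: $\Gamma$ is the set of deterministic Markov policies, i.e. sequences $\underline\gamma=(\gamma_t)_{t=0}^{T-1}$ of measurable maps $\gamma_t:\mathcal P(\mathbb X)^K\to\mathbb U$. Under $\underline\gamma$: $U_t=\gamma_t(\mu_t^1,\dots,\mu_t^K)$, $\mu_{t+1}^k=\Phi(\mu_t^k,U_t)$, and $V(\underline\gamma):=\frac1K\sum_{k=1}^KW_{2,\lambda}(\mu_T^k,\nu^k)^2$. For a fixed control sequence $\underline U=(U_t)_{t=0}^{T-1}\in\mathbb U^T$, $V(\underline U)$ is the same cost with $\mu_{t+1}^k=\Phi(\mu_t^k,U_t)$. Quantization: for each $n\in\mathbb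 N$, $\mathrm S_n\subset\mathrm S$ is a finite set with $\min_{s\in\mathrm S_n}\|x-s\|<\frac1n$ for all $x\in\mathrm S$; $\mathbb X_n:=\mathrm{PE}_N\times\mathrm S_n$; $Q^{(n)}:\mathbb X\to\mathbb X_n$, $Q^{(n)}(p,x):=(p,\operatorname{argmin}_{s\in\mathrm S_n}\|x-s\|)$ with ties broken measurably. For each $m\in\mathbb N$, $\mathbb U_m\subset\mathbb U$ is finite with $\min_{U'\in\mathbb U_m}\|U'-U\|_{\mathbb U}\le\frac1m$ for all $U\in\mathbb U$. For $\ell\in\mathbb N$, $\mathcal P^{(\ell)}(\mathbb X_n)$ is the set of probability measures on $\mathbb X_n$ all of whose point masses are integer multiples of $1/\ell$, and $R_\ell:\mathcal P(\mathbb X_n)\to\mathcal P^{(\ell)}(\mathbb X_n)$ is a quantizer mapping each measure to a closest element of $\mathcal P^{(\ell)}(\mathbb X_n)$ in the sense of $W_{2,\lambda}$. Put $f_n(\cdot;U,\mu):=Q^{(n)}(f(\cdot,U,\mu))$, $\Phi^{(n)}(\mu,U):=\mu\circ f_n(\cdot;U,\mu)^{-1}$ and $\Phi^{(\ell,n,m)}(\hat\mu,U):=R_\ell(\Phi^{(n)}(\hat\mu,U))$ for $\hat\mu\in\mathcal P^{(\ell)}(\mathbb X_n)$, $U\in\mathbb U_m$. $\mathsf{MDP}^{(\ell,n,m)}$ is the deterministic control problem with state space $\mathcal P^{(\ell)}(\mathbb X_n)^K$, action space $\mathbb U_m$, initial state $\hat\mu_0^k:=R_\ell(\mu_0^k\circ(Q^{(n)})^{-1})$,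 dynamics $\hat\mu_{t+1}^k=\Phi^{(\ell,n,m)}(\hat\mu_t^k,U_t)$ (same action for all $k$), and terminal cost $V^{(\ell,n,m)}(\underline U):=\frac1K\sum_{k=1}^KW_{2,\lambda}(\hat\mu_T^k,\hat\nu^k)^2$ with $\hat\nu^k:=R_\ell(\nu^k\circ(Q^{(n)})^{-1})$. A sequence $\underline U\in\mathbb U_m^T$ is optimal for $\mathsf{MDP}^{(\ell,n,m)}$ if it minimizes $V^{(\ell,n,m)}$ over $\mathbb U_m^T$.
   Formalization: The activation function σ is assumed continuous (which covers every 1-Lipschitz σ); for an arbitrary discontinuous σ the claim fails, e.g. a step function on S=[0,1] whose jump sits at the data point. *)

(* Defs.v *)
From HB Require Import structures.
From mathcomp Require Import all_boot all_order all_algebra.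
From mathcomp Require Import all_classical all_reals all_analysis.

Set Implicit Arguments.
Unset Strict Implicit.
Unset Printing Implicit Defensive.

Import Order.TTheory GRing.Theory Num.Theory.
Import numFieldNormedType.Exports.

Local Open Scope classical_set_scope.
Local Open Scope ring_scope.

HB.instance Definition _ (T U : ptopologicalType) := Pointed.on (T * U)%type.

Notation borel T := (g_sigma_algebraType (@open T)).

Section probabilities.
Context (R : realType).

(* The probability measure that takes the values m on measurable sets; it is
   arbitrary if there is no such measure (see mkprobE). *)
Definition mkprob d (T : measurableType d) (m : set T -> \bar R) :
    probability T R :=
  get [set P : probability T R | forall B, measurable B -> P B = m B].

Lemma mkprobE d (T : measurableType d) (m : {measure set T -> \bar R}) :
  m setT = 1%E -> forall B, measurable B -> mkprob m B = m B.
Proof.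
move=> m1.
pose P : probability T R := mnormalize m (dirac point : probability T R).
have Pm : exists P : probability T R, forall B, measurable B -> P B = m B.
  exists P => B mB.
  by rewrite /P /= /mnormalize m1 onee_eq0 /= invr1 mule1.
exact: (getPex Pm).
Qed.

(* Probability measures on a measurable set D are represented by probability
   measures on the ambient space that give mass 1 to D. *)
Definition probs d (T : measurableType d) (D : set T) : set (probability T R) :=
  [set mu | mu D = 1%E].

Definition push_fun d d' (T : measurableType d) (T' : measurableType d')
    (D : set T) (f : T -> T') (mu : probability T R) : set T' -> \bar R :=
  fun B => mu (D `&` f @^-1` B).

(* image of mu, which is carried by D, under a map f that only matters on D *)
Definition push d d' (T : measurableType d) (T' : measurableType d')
    (D : set T) (f : T -> T') (mu : probability T R) : probability T' R :=
  mkprob (push_fun D f mu).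

Section push_measure.
Context d d' (T : measurableType d) (T' : measurableType d').
Variables (D : set T) (f : T -> T') (mu : probability T R).
Hypotheses (mD : measurable D) (mf : measurable_fun D f).

Local Notation pm := (push_fun D f mu).

Let pm0 : pm set0 = 0%E.
Proof. by rewrite /push_fun preimage_set0 setI0 measure0. Qed.

Let pm_ge0 B : (0 <= pm B)%E.
Proof. exact: measure_ge0. Qed.

Let pm_sigma_additive : semi_sigma_additive pm.
Proof.
move=> F mF tF mUF; rewrite /push_fun preimage_bigcup setI_bigcupr.
apply: measure_semi_sigma_additive.
- by move=> n; exact: mf.
- by apply: trivIset_setIl; apply/trivIsetP => i j _ _ ij;
    rewrite -preimage_setI; move/trivIsetP : tF => /(_ _ _ _ _ ij) ->//;
    rewrite preimage_set0.
- by rewrite -setI_bigcupr -preimage_bigcup; exact: mf.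
Qed.

HB.instance Definition _ := isMeasure.Build _ _ _ pm
  pm0 pm_ge0 pm_sigma_additive.

Lemma pushE : probs D mu ->
  forall B, measurable B -> push D f mu B = mu (D `&` f @^-1` B).
Proof.
move=> muD; apply: (@mkprobE _ _ (pm : {measure set T' -> \bar R})).
by rewrite /= /push_fun preimage_setT setIT.
Qed.

End push_measure.

Definition empirical d (T : measurableType d) n (x : 'I_n -> T) :
    probability T R :=
  mkprob (fun B => (n%:R^-1)%:E * \sum_(i < n) \d_(x i) B)%E.

Lemma empiricalE d (T : measurableType d) n (x : 'I_n -> T) : (0 < n)%N ->
  forall B, measurable B ->
  empirical x B = ((n%:R^-1)%:E * \sum_(i < n) \d_(x i) B)%E.
Proof.
move=> n0.
case: n n0 x => // n _ x.
have c0 : 0 <= n.+1%:R^-1 :> R by rewrite invr_ge0.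
pose s : {measure set T -> \bar R} :=
  mscale (NngNum c0)
    (msum (fun i => dirac (x (inord i)) : {measure set T -> \bar R}) n.+1).
have sE B : s B = ((n.+1%:R^-1)%:E * \sum_(i < n.+1) \d_(x i) B)%E.
  rewrite /s /= /mscale /= /msum; congr (_ * _)%E.
  by apply: eq_bigr => i _; rewrite inord_val.
move=> B mB; rewrite -sE -(@mkprobE _ _ s) //; last first.
  rewrite sE (eq_bigr (fun=> 1%E)); last by move=> i _; rewrite diracT.
  by rewrite sumEFin big_const_ord iter_addr_0 -EFinM mulVf.
by rewrite /empirical; congr (mkprob _ B); apply/funext => C; rewrite sE.
Qed.

Definition couplings d (T : measurableType d) (P Q : probability T R) :
    set (probability (T * T)%type R) :=
  [set pi | (forall A, measurable A -> pi (A `*` setT) = P A) /\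
            (forall B, measurable B -> pi (setT `*` B) = Q B)].

End probabilities.
Arguments push {R d d' T T'}.
Arguments empirical {R d T n}.

Section policies.
Context (R : realType) (X : ptopologicalType) (D : set X) (K : nat).

Definition bounded_continuous :=
  {phi : X -> R | {within D, continuous phi} /\
                  exists M, forall x, D x -> `|phi x| <= M}.

Definition weak_eval (mu : 'I_K -> probability (borel X) R) :
    {ptws 'I_K * bounded_continuous -> R} :=
  fun kphi => \int[mu kphi.1]_(x in D) (sval kphi.2 x).

(* On K-tuples of probability measures carried by D, this is the K-th power of
   the topology of weak convergence. *)
Definition weak_power := initial_topology weak_eval.

Definition prob_tuples : set ('I_K -> probability (borel X) R) :=
  [set mu | forall k, probs (D : set (borel X)) (mu k)].

Lemma measurable_prob_tuples : measurable (D : set (borel X)) ->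
  measurable (prob_tuples : set (borel weak_power)).
Proof.
move=> mD.
have c1 : {within D, continuous (cst 1 : X -> R)} /\
    exists M, forall x, D x -> `|(cst 1 : X -> R) x| <= M.
  split; first by apply: continuous_subspaceT => x; exact: cvg_cst.
  by exists 1 => x _; rewrite normr1.
pose one : bounded_continuous := exist _ _ c1.
pose A k : set weak_power := weak_eval @^-1` [set h | h (k, one) = 1].
have -> : prob_tuples = \bigcap_(k in [set: 'I_K]) A k.
  apply/seteqP; split => mu.
    move=> h k _; rewrite /A /= /weak_eval /= /Rintegral integral_cst //.
    by have := h k; rewrite /probs /= => ->; rewrite mul1e.
  move=> h k; have := h k Logic.I.
  rewrite /A /= /weak_eval /= /Rintegral integral_cst // mul1e => muD.
  by rewrite /probs /= -(fineK (fin_num_measure (mu k) _ mD)) muD.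
apply: fin_bigcap_measurable => [|k _]; first exact: finite_finset.
rewrite -[A k]setCK; apply: measurableC; apply: sub_sigma_algebra.
exists [set h : {ptws 'I_K * bounded_continuous -> R} | h (k, one) != 1].
  have -> : [set h : {ptws 'I_K * bounded_continuous -> R} | h (k, one) != 1] =
     (proj (k, one)) @^-1` [set x : R | x != 1] by [].
  apply: open_comp; last exact: open_neq.
  move=> h _; have /cvg_sup/(_ (k, one)) hh : h --> h by exact: cvg_id.
  by move=> Q nQ; apply: hh; exact: (@initial_continuous _ _
    (fun f : 'I_K * bounded_continuous -> R => f (k, one)) h Q nQ).
by apply/seteqP; split => mu /= /eqP.
Qed.

Definition policy_measurable (Y : ptopologicalType)
    (g : ('I_K -> probability (borel X) R) -> Y) :=
  @measurable_fun _ _ (borel weak_power) (borel Y) prob_tuples g.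

End policies.

Section euclidean.
Context (R : realType).

Definition dotmx m n (A B : 'M[R]_(m, n)) : R :=
  \sum_(i < m) \sum_(j < n) A i j * B i j.

(* Frobenius norm; on column vectors this is the Euclidean norm (whereas the
   library norm `|A| on matrices is the sup norm). *)
Definition frob m n (A : 'M[R]_(m, n)) : R := Num.sqrt (dotmx A A).

Definition diam2 m n (A : set 'M[R]_(m, n)) : R :=
  sup [set frob (xy.1 - xy.2) | xy in A `*` A].

End euclidean.

Notation tokenT R d := (R * 'cV[R]_d)%type.

(* (W, A, b, Q, K, V) *)
Notation paramT R d d1 d2 :=
  ('M[R]_(d, d1) * 'M[R]_(d1, d) * 'cV[R]_d1 *
   'M[R]_(d2, d) * 'M[R]_(d2, d) * 'M[R]_(d, d))%type.

Section transformer.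
Context (R : realType) (N d d1 d2 : nat).

Local Notation token := (tokenT R d).
Local Notation param := (paramT R d d1 d2).

Definition position (i : 'I_N) : R := i.+1%:R / N%:R.

Definition tokens (S : set 'cV[R]_d) : set token := range position `*` S.

Definition param_norm (U : param) : R :=
  let: (W, A, b, Q, K, V) := U in
  Num.sqrt (frob W ^+ 2 + frob A ^+ 2 + frob b ^+ 2 +
            frob Q ^+ 2 + frob K ^+ 2 + frob V ^+ 2).

Local Notation P := (probability (borel token) R).

Definition W2 (lambda : R) (P1 P2 : P) : \bar R :=
  sqrte (ereal_inf
    [set \int[pi]_z (frob (z.1.2 - z.2.2) ^+ 2
                     + lambda * (z.1.1 - z.2.1) ^+ 2)%:E
    | pi in couplings P1 P2])%E.

Section dynamics.
Context (beta : R) (sigma : 'cV[R]_d1 -> 'cV[R]_d1) (S : set 'cV[R]_d).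

Definition feature_marginal (mu : P) : probability (borel 'cV[R]_d) R :=
  push (tokens S : set (borel token)) (snd : borel token -> borel 'cV[R]_d) mu.

Definition attention (Q K : 'M[R]_(d2, d)) (V : 'M[R]_d) (mu : P)
    (x : 'cV[R]_d) : 'cV[R]_d :=
  let weight z := expR (beta * dotmx (Q *m x) (K *m z)) in
  let muS := feature_marginal mu in
  (\int[muS]_(z in S) weight z)^-1 *:
  \col_i \int[muS]_(z in S) (weight z * (V *m z) i ord0).

Definition layer (px : token) (U : param) (mu : P) : token :=
  let: (W, A, b, Q, K, V) := U in
  (px.1, W *m sigma (A *m px.2 + b) + attention Q K V mu px.2).

Definition Phi (mu : P) (U : param) : P :=
  push (tokens S : set (borel token))
    ((fun px => layer px U mu) : borel token -> borel token) mu.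

Definition quantize (q : 'cV[R]_d -> 'cV[R]_d) (px : token) : token :=
  (px.1, q px.2).

Definition quantized_law (q : 'cV[R]_d -> 'cV[R]_d) (mu : P) : P :=
  push (tokens S : set (borel token))
    (quantize q : borel token -> borel token) mu.

Definition Phi_quantized (q : 'cV[R]_d -> 'cV[R]_d) (mu : P) (U : param) : P :=
  push (tokens S : set (borel token))
    ((fun px => quantize q (layer px U mu)) : borel token -> borel token) mu.

End dynamics.

(* probability measures on Xn whose point masses are multiples of 1 / l *)
Definition grid_probs (l : nat) (Xn : set token) : set P :=
  [set mu | probs (Xn : set (borel token)) mu /\
     forall z, Xn z -> exists j : nat, mu [set z] = (j%:R / l%:R)%:E].

Definition measure_quantizer (lambda : R) (l : nat) (Xn : set token)
    (r : P -> P) :=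
  forall mu, probs (Xn : set (borel token)) mu ->
    grid_probs l Xn (r mu) /\
    forall nu, grid_probs l Xn nu -> (W2 lambda mu (r mu) <= W2 lambda mu nu)%E.

(* q is a measurable selection of argmin_(s in Sn) |x - s| on S *)
Definition nearest_point_map (S Sn : set 'cV[R]_d)
    (q : 'cV[R]_d -> 'cV[R]_d) :=
  measurable_fun (S : set (borel 'cV[R]_d))
    (q : borel 'cV[R]_d -> borel 'cV[R]_d) /\
  forall x, S x -> Sn (q x) /\ forall s, Sn s -> frob (x - q x) <= frob (x - s).

End transformer.

Section control.
Context (R : realType) (d : nat) (A : Type) (K : nat).
Local Notation P := (probability (borel (tokenT R d)) R).

(* Time indices range over nat; only the values at t < T matter for the law at
   time T. *)
Fixpoint closed_loop (F : P -> A -> P) (gamma : nat -> ('I_K -> P) -> A)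
    (mu0 : 'I_K -> P) (t : nat) : 'I_K -> P :=
  if t is t'.+1 then
    let mu := closed_loop F gamma mu0 t' in
    fun k => F (mu k) (gamma t' mu)
  else mu0.

Definition open_loop (F : P -> A -> P) (U : nat -> A) :=
  closed_loop F (fun t _ => U t).

Definition terminal_cost (lambda : R) (nu mu : 'I_K -> P) : \bar R :=
  ((K%:R^-1)%:E * \sum_(k < K) W2 lambda (mu k) (nu k) ^+ 2)%E.

Definition control_seq (T : nat) (AA : set A) (U : nat -> A) :=
  forall t, (t < T)%N -> AA (U t).

Definition optimal_control (T : nat) (AA : set A) (V : (nat -> A) -> \bar R)
    (U : nat -> A) :=
  control_seq T AA U /\
  forall U', control_seq T AA U' -> (V U <= V U')%E.

End control.

Definition markov_policy (R : realType) (d d1 d2 K T : nat)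
    (X : set (tokenT R d)) (UU : set (paramT R d d1 d2))
    (gamma : nat -> ('I_K -> probability (borel (tokenT R d)) R) ->
             paramT R d d1 d2) :=
  forall t, (t < T)%N ->
    @policy_measurable R (tokenT R d) X K (paramT R d d1 d2) (gamma t) /\
    forall mu, @prob_tuples R (tokenT R d) X K mu -> UU (gamma t mu).

(* Main.v *)
(** Every law that occurs is finitely supported, so couplings, gluing of
    couplings and W_2 reduce to finite weighted sums; closeness of laws is
    measured by the mean distance under a finite coupling.  By compactness the
    layer and the transport cost are Lipschitz up to an arbitrarily small
    additive error, and such estimates survive averaging over a coupling: one
    step of the dynamics is continuous in (law, parameter), and the squared W_2
    is continuous in both laws.  The grid approximation on X_n is uniform in n:
    merge the atoms according to their cells in one fixed net of X, then round
    the cell masses down to multiples of 1/l and put the defect on a single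
    point.  Hence for large l, n, m the quantized trajectories follow the true
    ones uniformly in the controls.  Finally, since the dynamics are
    deterministic, a Markov policy is no better than the control sequence it
    plays along its own trajectory. *)

Require Import Defs.
From mathcomp Require Import all_boot all_order all_algebra.
From mathcomp Require Import all_classical all_reals all_analysis.
From mathcomp Require Import measurable_realfun measurable_fun_approximation.
From mathcomp Require Import ring lra.

Set Implicit Arguments.
Unset Strict Implicit.
Unset Printing Implicit Defensive.

Import Order.TTheory GRing.Theory Num.Theory.
Import numFieldNormedType.Exports.

Local Open Scope classical_set_scope.
Local Open Scope ring_scope.

(** * Uniform continuity on compact sets *)

(** The three indices tend to infinity independently, so no threshold on [l] may depend on [n].
    Rounding the atoms of a law on X_n one by one would leave a defect of order |X_n| / l, which can
    grow with n; this is why the rounding is done on cells whose number depends only on the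
    tolerance.

    Errors are propagated in a W_1-type quantity rather than in W_2: the squared cost has no
    triangle inequality, whereas mean distances add up under gluing. Two affine bounds translate
    between the two: the cost is almost Lipschitz on the compact token space, and t <= e + t^2 / e
    bounds a distance by its square.

    Attention is a quotient of two averages over the law. Compactness keeps the softmax weights away
    from zero, so the quotient has a modulus of continuity that is the same for all laws, hence for
    all trajectories.

    The final error is not computed: it is the infimum of all admissible error bounds, so its
    convergence only asks that every positive tolerance be eventually admissible. *)

Lemma compact_norm_bounded (R : realType) (M V : normedModType R) (K : set M)
    (phi : M -> V) :
  compact K -> continuous phi ->
  exists B, 0 <= B /\ forall a, K a -> `|phi a| <= B.
Proof.
move=> cK cphi.
have /compact_bounded [B [_ hB]] : compact (phi @` K).
  by apply: continuous_compact => //; exact: continuous_subspaceT.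
exists (`|B| + 1); split; first by rewrite addr_ge0.
by move=> a Ka; apply: hB; [rewrite ltr_pwDr// ler_norm | exists a].
Qed.

(* Uniform continuity in a form that is affine in the distance, so that it can
   be averaged over a coupling. *)
Lemma compact_almost_lipschitz (R : realType) (M V : normedModType R)
    (K : set M) (phi : M -> V) :
  compact K -> continuous phi -> forall e, 0 < e ->
  exists L, 0 <= L /\
    forall a b, K a -> K b -> `|phi a - phi b| <= e + L * `|a - b|.
Proof.
move=> cK cphi e e0.
have [d /= d0 hd] : exists2 d, 0 < d & forall a b, K a -> K b ->
    `|a - b| < d -> `|phi a - phi b| <= e.
  (* A uniform radius is extracted by compactness: near-covering along the filter of positive [d]
     tending to 0 turns the local radii into one that serves all points of [K]. *)
  have /compact_near_coveringP/near_covering_withinP cvK := cK.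
  have := cvK R (0 : R)^'+ (fun d a => forall b, K b -> `|a - b| < d ->
    `|phi a - phi b| <= e) _.
  case; first move=> x Kx.
    have e20 : 0 < e / 2 by rewrite divr_gt0.
    have /cvgrPdist_lt /(_ _ e20) /nbhs_ballP [r /= r0 hr] := cphi x.
    exists (ball x (r / 2), [set d | 0 < d < r / 2]); first split => /=.
    - by apply: nbhsx_ballx; rewrite divr_gt0.
    - near=> d; apply/andP; split; near: d; first exact: nbhs_right_gt.
      by apply: nbhs_right_lt; rewrite divr_gt0.
    move=> [x' d] /= [xx' /andP[d0 dr]] Kx' b Kb x'b.
    have h1 : `|phi x - phi x'| < e / 2.
      by apply: hr; apply: le_ball xx'; rewrite ler_pdivrMr// ler_pMr// ler1n.
    have h2 : `|phi x - phi b| < e / 2.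
      apply: hr; rewrite [r]splitr; apply: ball_triangle xx' _.
      by rewrite -ball_normE /=; apply: lt_trans dr.
    rewrite (le_trans (ler_distD (phi x) _ _))// [e]splitr.
    by rewrite lerD// ltW// distrC.
  move=> x /= x0 hx; exists (x / 2); first by rewrite divr_gt0.
  move=> a b Ka Kb; apply: (hx (x / 2)) => //=; last by rewrite divr_gt0.
  rewrite sub0r normrN gtr0_norm ?divr_gt0//.
  by rewrite ltr_pdivrMr// ltr_pMr// ltr1n.
have [B [B0 hB]] := compact_norm_bounded cK cphi.
(* Pairs closer than [d] are absorbed by [e]. For the others the difference is at most [2 * B],
   which is at most [2 * B / d] times the distance. *)
exists (2 * B / d); split; first by rewrite divr_ge0 ?mulr_ge0// ltW.
move=> a b Ka Kb; have [abd|dab] := ltP `|a - b| d.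
  rewrite (le_trans (hd _ _ Ka Kb abd))// lerDl !mulr_ge0 ?invr_ge0//.
  exact: ltW.
rewrite (le_trans (ler_normB _ _))// (@le_trans _ _ (2 * B))//.
  by rewrite mulr_natl mulr2n lerD// hB.
rewrite (@le_trans _ _ (2 * B / d * `|a - b|))//; last by rewrite lerDr ltW.
by rewrite -mulrA ler_peMr ?mulr_ge0// mulrC ler_pdivlMr// mul1r.
Unshelve. all: by end_near. Qed.

Lemma continuous_sum (R : realType) (X : topologicalType)
    (V : normedModType R) (I : finType) (f : I -> X -> V) :
  (forall i, continuous (f i)) -> continuous (fun x => \sum_i f i x).
Proof. by move=> cf; apply: continuous_big => //; exact: add_continuous. Qed.

Lemma continuous_compose (X Y Z : topologicalType) (g : Y -> Z) (f : X -> Y) :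
  continuous g -> continuous f -> continuous (fun x => g (f x)).
Proof.
by move=> cg cf x; apply: (continuous_comp (f := f)); [exact: cf|exact: cg].
Qed.

Lemma continuous_fst (X Y Z : topologicalType) (f : X -> Y * Z) :
  continuous f -> continuous (fun x => (f x).1).
Proof. by apply: continuous_compose => x; exact: cvg_fst. Qed.

Lemma continuous_snd (X Y Z : topologicalType) (f : X -> Y * Z) :
  continuous f -> continuous (fun x => (f x).2).
Proof. by apply: continuous_compose => x; exact: cvg_snd. Qed.

Lemma continuous_pair (X Y Z : topologicalType) (f : X -> Y) (g : X -> Z) :
  continuous f -> continuous g -> continuous (fun x => (f x, g x)).
Proof. by move=> cf cg x; exact: (cvg_pair (cf x) (cg x)). Qed.

Section matrix_continuity.
Context (R : realType) (X : topologicalType).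

Lemma continuous_mx m n (f : X -> 'M[R]_(m, n)) :
  (forall i j, continuous (fun x => f x i j)) -> continuous f.
Proof.
move=> cf x; apply/cvgrPdist_lt => e e0.
near=> y.
have : ball (f x) e (f y); last by rewrite -ball_normE.
split => //.
near: y.
apply: filter_forall => i; apply: filter_forall => j.
by have /cvgrPdist_lt /(_ _ e0) := cf i j x; rewrite -ball_normE.
Unshelve. all: by end_near. Qed.

Lemma continuous_entry m n (f : X -> 'M[R]_(m, n)) i j :
  continuous f -> continuous (fun x => f x i j).
Proof.
move=> cf x; apply: (continuous_comp (g := fun A : 'M[R]_(m, n) => A i j)).
  exact: cf.
exact: coord_continuous.
Qed.

Lemma continuous_mulmx m n p (f : X -> 'M[R]_(m, n)) (g : X -> 'M[R]_(n, p)) :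
  continuous f -> continuous g -> continuous (fun x => f x *m g x).
Proof.
move=> cf cg; apply: continuous_mx => i j.
under eq_fun do rewrite mxE.
by apply: continuous_sum => k x; apply: cvgM; exact: continuous_entry.
Qed.

Lemma continuous_dotmx m n (f g : X -> 'M[R]_(m, n)) :
  continuous f -> continuous g -> continuous (fun x => Defs.dotmx (f x) (g x)).
Proof.
move=> cf cg; rewrite /Defs.dotmx.
apply: (@continuous_sum R X R^o) => i; apply: (@continuous_sum R X R^o) => j x.
by apply: cvgM; exact: continuous_entry.
Qed.

End matrix_continuity.

(** * Finitely supported laws *)

Section finite_laws.
Context (R : realType) d (T : measurableType d).

(** P is the sum of the [w i] times Dirac masses at [x i]. Points may repeat and weights may vanish:
    a push-forward then keeps index set and weights, and two laws over the same [I] and [w] are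
    coupled. *)
Definition is_law (P : probability T R) (I : finType) (w : I -> R)
    (x : I -> T) :=
  (forall i, 0 <= w i) /\
  forall B, measurable B -> P B = (\sum_i w i * \1_B (x i))%:E.

Lemma law_sum1 P (I : finType) (w : I -> R) x : is_law P w x -> \sum_i w i = 1.
Proof.
move=> [_ /(_ setT measurableT)]; rewrite probability_setT => /esym[<-].
by apply: eq_bigr => i _; rewrite indicT mulr1.
Qed.

Lemma law_full P (I : finType) (w : I -> R) x (D : set T) :
  is_law P w x -> measurable D -> (forall i, D (x i)) -> probs D P.
Proof.
move=> Px mD Dx; rewrite /probs /= (Px.2 _ mD).
rewrite (eq_bigr w) ?(law_sum1 Px)// => i _.
by rewrite indicE mem_set// mulr1.
Qed.

Lemma probability_full_setI (P : probability T R) (A B : set T) :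
  measurable A -> measurable B -> P A = 1%E -> P (B `&` A) = P B.
Proof.
move=> mA mB PA; rewrite [in RHS](measureDI P mB mA).
rewrite [X in _ = (X + _)%E](_ : _ = 0%E) ?add0e//; apply/eqP.
rewrite eq_le measure_ge0 andbT (@le_trans _ _ (P (~` A)))//.
  apply: le_measure; rewrite ?inE//; first exact: measurableD.
    exact: measurableC.
by rewrite probability_setC// PA subee.
Qed.

(** Brings an arbitrary coupling into finite form once it is known to be carried by finitely many
    pairs. *)
Lemma finite_support_law (P : probability T R) (s : seq T) :
  P [set` s] = 1%E -> (forall z, measurable [set z : T]) ->
  is_law P (fun z : seq_sub s => fine (P [set val z])) val.
Proof.
move=> Ps m1; split=> [z|B mB]; first exact: fine_ge0.
have ms : measurable [set` s].
  by apply: countable_measurable => //; exact/finite_set_countable/finite_seq.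
rewrite -(probability_full_setI ms mB Ps).
have -> : B `&` [set` s] =
    \bigcup_(z in [set: seq_sub s]) (B `&` [set val z]).
  apply/seteqP; split => [z [Bz sz]|z [z' _ [Bz zE]]].
    by exists (SeqSub sz).
  by split => //; rewrite /= zE; exact: ssvalP.
rewrite measure_fin_bigcup//=; last 2 first.
- by move=> i j _ _ [z [[_ /= ->] [_ /= /val_inj]]].
- by move=> z _; exact: measurableI.
rewrite (fsbigTE (fset_set [set: seq_sub s])); last first.
  by move=> z; rewrite in_fset_set ?mem_set //; exact: finite_finset.
rewrite -sumEFin (perm_big (index_enum (seq_sub s))); last first.
  apply: uniq_perm; [exact: finmap.fset_uniq|exact: index_enum_uniq|move=> z].
  by rewrite in_fset_set ?mem_index_enum ?mem_set //; exact: finite_finset.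
apply: eq_bigr => z _; rewrite indicE EFinM fineK ?fin_num_measure//.
have [Bz|Bz] := pselect (B (val z)).
  rewrite mem_set// mule1; congr (P _); apply/seteqP; split => [t []//|t ->].
  by split.
rewrite memNset// mule0 -(measure0 P); congr (P _).
by apply/seteqP; split => // t [Bt tz]; apply: Bz; move: Bt; rewrite tz.
Qed.

Lemma law_empirical n (x : 'I_n -> T) : (0 < n)%N ->
  is_law (empirical x) (fun=> n%:R^-1) x.
Proof.
move=> n0; split => [_|B mB]; first by rewrite invr_ge0.
by rewrite empiricalE// -mulr_sumr EFinM -sumEFin.
Qed.

(** [msum] is indexed by natural numbers, hence the enumeration of [I] with default [i0]. *)
Definition law_measure (I : finType) (i0 : I) (w : I -> {nonneg R})
    (x : I -> T) : {measure set T -> \bar R} :=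
  msum (fun n => mscale (w (nth i0 (enum I) n)) \d_(x (nth i0 (enum I) n)))
    #|I|.

Lemma sum_nth_enum (I : finType) (i0 : I) (V : nmodType) (F : I -> V) :
  \sum_(n < #|I|) F (nth i0 (enum I) n) = \sum_i F i.
Proof.
rewrite -[RHS](big_enum _ _ predT) (big_nth i0) big_mkord -cardT.
by [].
Qed.

Lemma law_measureE (I : finType) i0 (w : I -> {nonneg R}) (x : I -> T) B :
  @law_measure I i0 w x B = (\sum_i (w i)%:num * \1_B (x i))%:E.
Proof.
rewrite /law_measure /msum /= -sumEFin -(sum_nth_enum i0).
by apply: eq_bigr => n _; rewrite /mscale /= EFinM.
Qed.

Lemma law_measure_integral (I : finType) i0 (w : I -> {nonneg R}) (x : I -> T)
    (D : set T) (f : T -> \bar R) :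
  measurable D -> measurable_fun D f -> (forall y, D y -> 0 <= f y)%E ->
  (forall i, D (x i)) ->
  (\int[@law_measure I i0 w x]_(y in D) f y
   = \sum_i (w i)%:num%:E * f (x i))%E.
Proof.
move=> mD mf f0 Dx; rewrite ge0_integral_measure_sum// -(sum_nth_enum i0).
apply: eq_bigr => n _; rewrite ge0_integral_mscale// integral_dirac//.
by rewrite diracE mem_set// mul1e.
Qed.

Lemma law_nonempty P (I : finType) (w : I -> R) x : is_law P w x -> I.
Proof.
move=> Px; suff /card_gt0P/sigW[i _] : (0 < #|I|)%N by exact: i.
rewrite lt0n; apply/eqP => /card0_eq I0; have := law_sum1 Px.
rewrite big1 => [/esym/eqP|i _]; first by rewrite oner_eq0.
by have := I0 i; rewrite inE.
Qed.

Lemma law_integral_ge0 P (I : finType) (w : I -> R) x (D : set T)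
    (f : T -> \bar R) :
  is_law P w x ->
  measurable D -> measurable_fun D f -> (forall y, D y -> 0 <= f y)%E ->
  (forall i, D (x i)) ->
  (\int[P]_(y in D) f y = \sum_i (w i)%:E * f (x i))%E.
Proof.
move=> Px mD mf f0 Dx; pose w' i := NngNum (Px.1 i).
rewrite -(law_measure_integral (law_nonempty Px) w' mD mf f0 Dx).
by apply: eq_measure_integral => A mA _; rewrite law_measureE; exact: Px.2.
Qed.

Lemma law_Rintegral P (I : finType) (w : I -> R) x (D : set T) (f : T -> R) :
  is_law P w x -> measurable D -> measurable_fun D f -> (forall i, D (x i)) ->
  \int[P]_(y in D) f y = \sum_i w i * f (x i).
Proof.
move=> Px mD mf Dx; rewrite /Rintegral integralE.
have mf' : measurable_fun D (EFin \o f) by exact/measurable_EFinP.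
rewrite (law_integral_ge0 Px mD (measurable_funepos mf'))//.
rewrite (law_integral_ge0 Px mD (measurable_funeneg mf'))//.
under eq_bigr do rewrite funeposE /= -EFin_max -EFinM.
under [X in (_ - X)%E]eq_bigr do rewrite funenegE /= -EFin_max -EFinM.
rewrite !sumEFin -EFinB /= -sumrB; apply: eq_bigr => i _.
rewrite -mulrBr; congr (_ * _).
have [f0|f0] := leP 0 (f (x i)).
  by rewrite max_r ?oppr_le0// subr0.
by rewrite max_l ?oppr_ge0 ?(ltW f0)// sub0r opprK.
Qed.

Lemma law_exists (I : finType) (w : I -> R) (x : I -> T) :
  (forall i, 0 <= w i) -> \sum_i w i = 1 -> exists P, is_law P w x.
Proof.
move=> w0 w1.
have i0 : I.
  suff /card_gt0P/sigW[i _] : (0 < #|I|)%N by exact: i.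
  rewrite lt0n; apply/eqP => /card0_eq I0; move: w1.
  rewrite big1 => [/esym/eqP|i _]; first by rewrite oner_eq0.
  by have := I0 i; rewrite inE.
pose m := law_measure i0 (fun i => NngNum (w0 i)) x.
exists (mkprob m); split => // B mB.
rewrite mkprobE//; first by rewrite law_measureE.
rewrite law_measureE -w1; congr EFin; apply: eq_bigr => i _.
by rewrite indicT mulr1.
Qed.

(** The weight of each index may be spread over its fibre, as all points of the fibre coincide. This
    puts two laws over a common index set. *)
Lemma law_reindex P (I J : finType) (w : I -> R) x (u : J -> R) (h : J -> I) :
  is_law P w x -> (forall j, 0 <= u j) ->
  (forall i, \sum_(j | h j == i) u j = w i) -> is_law P u (x \o h).
Proof.
move=> [w0 Px] u0 uw; split => // B mB; rewrite Px//; congr EFin.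
rewrite [RHS](partition_big h predT)//=; apply: eq_bigr => i _.
by rewrite -uw mulr_suml; apply: eq_bigr => j /eqP ->.
Qed.

(** Two descriptions of the same law are matched: both give the atom at a point [t] the mass [q t],
    so the indices sitting at [t] can be paired independently. *)
Lemma glue Q (I J : finType) (w : I -> R) y (v : J -> R) z :
  (forall t, measurable [set t : T]) -> is_law Q w y -> is_law Q v z ->
  exists u : I * J -> R, [/\ forall k, 0 <= u k,
    forall i, \sum_(k | k.1 == i) u k = w i,
    forall j, \sum_(k | k.2 == j) u k = v j &
    forall k, u k != 0 -> y k.1 = z k.2].
Proof.
move=> m1 [w0 Qy] [v0 Qz].
pose q t := fine (Q [set t]).
have qw t : q t = \sum_(i | y i == t) w i.
  rewrite /q Qy//= [RHS]big_mkcond; apply: eq_bigr => i _; rewrite indicE.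
  by case: eqP => [->|yt]; [rewrite mem_set// mulr1|rewrite memNset// mulr0].
have qv t : q t = \sum_(i | z i == t) v i.
  rewrite /q Qz//= [RHS]big_mkcond; apply: eq_bigr => i _; rewrite indicE.
  by case: eqP => [->|yt]; [rewrite mem_set// mulr1|rewrite memNset// mulr0].
have q0 t : 0 <= q t by rewrite qw sumr_ge0.
(* Conditionally on the common point, the two indices are independent. *)
exists (fun k => if y k.1 == z k.2 then w k.1 * v k.2 / q (y k.1) else 0).
split.
- by move=> k; case: ifP => // _; rewrite divr_ge0 ?mulr_ge0.
- move=> i; rewrite (eq_bigl (fun k => (k.1 == i) && xpredT k.2)); last first.
    by move=> k; rewrite andbT.
  rewrite -(pair_big (pred1 i) predT
    (fun a b => if y a == z b then w a * v b / q (y a) else 0))/=.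
  rewrite big_pred1_eq -big_mkcond/= -mulr_suml -mulr_sumr.
  under eq_bigl do rewrite eq_sym.
  (* Over an atom of mass zero the quotient is 0, which is correct because [w i] is then 0 as
     well. *)
  rewrite -qv; have [qi|qi] := eqVneq (q (y i)) 0; last by rewrite mulfK.
  rewrite qi mulr0 mul0r; apply/esym/eqP; rewrite eq_le w0 andbT.
  by rewrite -qi qw (bigD1 i)//= lerDl sumr_ge0.
- move=> j; rewrite (eq_bigl (fun k => xpredT k.1 && (k.2 == j))); last by [].
  rewrite -(pair_big predT (pred1 j)
    (fun a b => if y a == z b then w a * v b / q (y a) else 0))/=.
  under eq_bigr do rewrite big_pred1_eq.
  rewrite -big_mkcond/=.
  under eq_bigr => i /eqP -> do rewrite mulrAC.
  rewrite -mulr_suml -mulr_suml -qw.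
  have [qi|qi] := eqVneq (q (z j)) 0; last by rewrite divff// mul1r.
  rewrite qi !mul0r; apply/esym/eqP; rewrite eq_le v0 andbT.
  by rewrite -qi qv (bigD1 j)//= lerDl sumr_ge0.
- by move=> k; case: (y k.1 =P z k.2) => // _; rewrite eqxx.
Qed.

End finite_laws.

Lemma law_push (R : realType) d d' (T : measurableType d)
    (T' : measurableType d') (P : probability T R) (I : finType) (w : I -> R) x
    (D : set T) (f : T -> T') :
  is_law P w x -> measurable D -> measurable_fun D f -> (forall i, D (x i)) ->
  is_law (push D f P) w (f \o x).
Proof.
move=> Px mD mf Dx; split => [|B mB]; first exact: Px.1.
rewrite pushE//; last exact: (law_full Px).
transitivity (\sum_i w i * \1_(D `&` f @^-1` B) (x i))%:E.
  exact: (Px.2 _ (mf mD _ mB)).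
congr EFin.
apply: eq_bigr => i _; congr (_ * _); rewrite !indicE; congr (nat_of_bool _)%:R.
apply/idP/idP; rewrite !inE/=; first by case.
by move=> Bf; split.
Qed.

(** * Borel sets and the transport cost *)

Section borel_sets.
Context (X : ptopologicalType).

Lemma borel_open (A : set X) : open A -> measurable (A : set (borel X)).
Proof. by move=> oA; exact: sub_sigma_algebra. Qed.

Lemma borel_closed (A : set X) : closed A -> measurable (A : set (borel X)).
Proof.
move=> cA; rewrite -[A]setCK; apply: measurableC.
by apply: borel_open; exact: closed_openC.
Qed.

Lemma borel_set1 (x : X) : hausdorff_space X ->
  measurable ([set x] : set (borel X)).
Proof.
move=> hX; apply: borel_closed.
exact/accessible_closed_set1/hausdorff_accessible.
Qed.

Lemma borel_continuous (Y : ptopologicalType) (f : X -> Y) :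
  continuous f -> measurable_fun setT (f : borel X -> borel Y).
Proof.
move=> /continuousP cf.
apply: (@measurability _ _ (borel X) (borel Y) setT f (@open Y)) => //.
move=> _ [B oB <-].
by rewrite setTI; apply: borel_open; exact: cf.
Qed.

Lemma borel_continuous_real (R : realType) (f : X -> R) :
  continuous f -> measurable_fun setT (f : borel X -> R).
Proof.
move=> /continuousP cf; apply: (measurability _ (RGenOpens.measurableE R)).
move=> _ [_ [a [b ->] <-]]; rewrite setTI; apply: borel_open.
exact/cf/interval_open.
Qed.

End borel_sets.

Section transport_cost.
Context (R : realType) (d : nat) (lambda : R).
Hypothesis lambda_gt0 : 0 < lambda.
Local Notation token := (tokenT R d).
Local Notation P := (probability (borel token) R).

Lemma frob_sqr m n (A : 'M[R]_(m, n)) :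
  frob A ^+ 2 = \sum_i \sum_j A i j ^+ 2.
Proof.
rewrite /frob sqr_sqrtr; first by do 2 (apply: eq_bigr => ? _); rewrite expr2.
by do 2 (apply: sumr_ge0 => ? _); rewrite -expr2 sqr_ge0.
Qed.

Lemma frob_ge0 m n (A : 'M[R]_(m, n)) : 0 <= frob A.
Proof. exact: sqrtr_ge0. Qed.

Lemma entry_le_frob m n (A : 'M[R]_(m, n)) i j : `|A i j| <= frob A.
Proof.
rewrite -ler_sqr ?nnegrE ?frob_ge0// frob_sqr real_normK ?num_real//.
rewrite (bigD1 i)//= (bigD1 j)//= -addrA lerDl addr_ge0//.
  by apply: sumr_ge0 => ? _; rewrite sqr_ge0.
by do 2 (apply: sumr_ge0 => ? _); rewrite sqr_ge0.
Qed.

Lemma mx_norm_le m n (A : 'M[R]_(m, n)) e :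
  0 <= e -> (forall i j, `|A i j| <= e) -> `|A| <= e.
Proof.
move=> e0 Ae; rewrite /Num.Def.normr /= mx_normrE.
by apply: bigmax_le => // ij _; exact: Ae.
Qed.

Lemma mx_norm_le_frob m n (A : 'M[R]_(m, n)) : `|A| <= frob A.
Proof.
by apply: mx_norm_le => [|i j]; [exact: frob_ge0|exact: entry_le_frob].
Qed.

Definition cost (a b : token) : R :=
  frob (a.2 - b.2) ^+ 2 + lambda * (a.1 - b.1) ^+ 2.

Lemma cost_ge0 a b : 0 <= cost a b.
Proof. by apply: addr_ge0; rewrite ?sqr_ge0// mulr_ge0 ?sqr_ge0// ltW. Qed.

Lemma cost_xx a : cost a a = 0.
Proof.
rewrite /cost !subrr expr0n mulr0 addr0 frob_sqr.
by rewrite big1// => i _; rewrite big1// => j _; rewrite mxE expr0n.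
Qed.

Lemma cost_continuous : continuous (fun ab : token * token => cost ab.1 ab.2).
Proof.
have c1 : continuous (fun ab : token * token => ab.1.1 - ab.2.1).
  move=> x; apply: cvgB; apply: continuous_fst => {}x; first exact: cvg_fst.
  exact: cvg_snd.
have c2 : continuous (fun ab : token * token => ab.1.2 - ab.2.2).
  move=> x; apply: cvgB; apply: continuous_snd => {}x; first exact: cvg_fst.
  exact: cvg_snd.
have sqr_cont (f : token * token -> R) : continuous f ->
    continuous (fun x => f x ^+ 2).
  by move=> cf x; under eq_fun do rewrite expr2; apply: cvgM; exact: cf.
have -> : (fun ab : token * token => cost ab.1 ab.2) = (fun ab =>
    (\sum_i \sum_j (ab.1.2 - ab.2.2) i j ^+ 2) + lambda * (ab.1.1 - ab.2.1) ^+ 2).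
  by apply/funext => ab; rewrite /cost frob_sqr.
move=> x; apply: cvgD; last first.
  by apply: cvgM; [exact: cvg_cst|exact: sqr_cont].
move: x; apply: (@continuous_sum R _ R^o) => i.
apply: (@continuous_sum R _ R^o) => j.
by apply: sqr_cont; exact: continuous_entry.
Qed.

(** For [t >= 0], either [t <= e] or [t <= t ^+ 2 / e]. Being affine in the cost, the bound can be
    averaged and stands in for the Cauchy-Schwarz inequality. The factor [1 + lambda^-1] covers both
    the feature and the position coordinate. *)
Lemma norm_le_cost e : 0 < e -> exists L, 0 <= L /\
  forall a b : token, `|a - b| <= e + L * cost a b.
Proof.
move=> e0; exists (e^-1 * (1 + lambda^-1)).
have l0 : 0 <= lambda^-1 by rewrite invr_ge0 ltW.
have ei0 : 0 <= e^-1 by rewrite invr_ge0 ltW.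
split; first by rewrite mulr_ge0// addr_ge0.
move=> a b.
have sq (t : R) : 0 <= t -> t <= e + e^-1 * t ^+ 2.
  move=> t0; have [te|et] := leP t e.
    by rewrite (le_trans te)// lerDl mulr_ge0// sqr_ge0.
  rewrite (@le_trans _ _ (e^-1 * t ^+ 2))//; last by rewrite lerDr ltW.
  by rewrite expr2 mulrCA ler_peMr// mulrC ler_pdivlMr// mul1r ltW.
have cf : frob (a.2 - b.2) ^+ 2 <= (1 + lambda^-1) * cost a b.
  rewrite mulrDl mul1r (@le_trans _ _ (cost a b))//.
    by rewrite lerDl mulr_ge0// ?sqr_ge0// ltW.
  by rewrite lerDl mulr_ge0// cost_ge0.
have cp : (a.1 - b.1) ^+ 2 <= (1 + lambda^-1) * cost a b.
  rewrite mulrDl mul1r (@le_trans _ _ (lambda^-1 * cost a b))//.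
    by rewrite /cost mulrDr mulKf ?gt_eqF// lerDr mulr_ge0// sqr_ge0.
  by rewrite lerDr cost_ge0.
rewrite prod_normE ge_max; apply/andP; split => /=.
  rewrite (le_trans (sq _ (normr_ge0 _)))// lerD2l -mulrA ler_wpM2l//.
  by rewrite real_normK ?num_real.
rewrite (le_trans (mx_norm_le_frob _))// (le_trans (sq _ (frob_ge0 _)))//.
by rewrite lerD2l -mulrA ler_wpM2l.
Qed.

Lemma token_set1 (z : token) : measurable ([set z] : set (borel token)).
Proof. by apply: borel_set1; exact: norm_hausdorff. Qed.

(** Couplings live on the product of two Borel sigma-algebras, not on the Borel sigma-algebra of the
    product, so measurability is built from coordinates instead of being read off continuity. *)
Lemma measurable_cost : measurable_fun setT
  (fun z : borel token * borel token => cost z.1 z.2).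
Proof.
have m1 (g : borel token -> R) : measurable_fun setT g ->
    measurable_fun setT (fun z : borel token * borel token => g z.1 - g z.2).
  by move=> mg; apply: measurable_funB; apply: measurableT_comp.
rewrite /cost; apply: measurable_funD; last first.
  apply: measurable_funM => //; apply: measurable_funX.
  by apply: (m1 fst); apply: borel_continuous_real => x; exact: cvg_fst.
under eq_fun do rewrite frob_sqr.
apply: measurable_sum => i; apply: measurable_sum => j; apply: measurable_funX.
under eq_fun do rewrite !mxE.
apply: (m1 (fun z => z.2 i j)); apply: borel_continuous_real.
by apply: continuous_entry => x; exact: cvg_snd.
Qed.

Lemma W2_sqr (P1 P2 : P) : (W2 lambda P1 P2 ^+ 2 =
  ereal_inf [set \int[pi]_z (cost z.1 z.2)%:E | pi in couplings P1 P2])%E.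
Proof.
rewrite /W2 sqr_sqrte//; apply: le_ereal_inf_tmp => _ [pi _ <-].
by apply: integral_ge0 => z _; rewrite lee_fin cost_ge0.
Qed.

Lemma W2_sqr_ge0 (P1 P2 : P) : (0 <= W2 lambda P1 P2 ^+ 2)%E.
Proof.
rewrite W2_sqr; apply: le_ereal_inf_tmp => _ [pi _ <-].
by apply: integral_ge0 => z _; rewrite lee_fin cost_ge0.
Qed.

(** The law of the pairs [(x i, y i)] with weights [w] is a competitor in the infimum. *)
Lemma W2_sqr_le (P1 P2 : P) (I : finType) (w : I -> R) x y :
  is_law P1 w x -> is_law P2 w y ->
  (W2 lambda P1 P2 ^+ 2 <= (\sum_i w i * cost (x i) (y i))%:E)%E.
Proof.
move=> P1x P2y; rewrite W2_sqr.
have [pi pixy] := law_exists (fun i => (x i, y i) : borel token * borel token)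
  P1x.1 (law_sum1 P1x).
have mpi A B : measurable A -> measurable B ->
    pi (A `*` B) = (\sum_i w i * (\1_A (x i) * \1_B (y i)))%:E.
  move=> mA mB.
  transitivity (\sum_i w i * \1_(A `*` B) (x i, y i))%:E.
    by apply: pixy.2; exact: measurableX.
  congr EFin; apply: eq_bigr => i _; congr (_ * _).
  by rewrite !indicE in_setX -natrM mulnb.
apply: ereal_inf_lbound; exists pi.
  split => A mA; rewrite mpi//.
    rewrite P1x.2//; congr EFin; apply: eq_bigr => i _.
    by rewrite indicT mulr1.
  rewrite P2y.2//; congr EFin; apply: eq_bigr => i _.
  by rewrite indicT mul1r.
rewrite (law_integral_ge0 pixy)//=.
- by rewrite -sumEFin.
- by apply/measurable_EFinP; exact: measurable_cost.
- by move=> z _; rewrite lee_fin cost_ge0.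
Qed.

(** No optimal coupling is needed: some coupling has cost below [r], and since its marginals have
    finite supports it is carried by the finite set [s] of pairs of atoms. *)
Lemma W2_sqr_lt (P1 P2 : P) (I J : finType) (w : I -> R) x (v : J -> R) y
    (D : set token) r :
  is_law P1 w x -> is_law P2 v y ->
  (forall i, D (x i)) -> (forall j, D (y j)) ->
  (W2 lambda P1 P2 ^+ 2 < r%:E)%E ->
  exists (H : finType) (u : H -> R) (f g : H -> borel token),
    [/\ is_law P1 u f, is_law P2 u g, (forall k, D (f k)), (forall k, D (g k)) &
        \sum_k u k * cost (f k) (g k) < r].
Proof.
move=> P1x P2y Dx Dy; rewrite W2_sqr => /ereal_inf_lt[_ [pi [pi1 pi2] <-]] pir.
pose s : seq (borel token * borel token) :=
  [seq (a, b) | a <- codom x, b <- codom y].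
have ms (I' : finType) (h : I' -> borel token) :
    measurable ([set` codom h] : set (borel token)).
  apply: countable_measurable => [z|]; first exact: token_set1.
  exact/finite_set_countable/finite_seq.
have full (P0 : P) (I' : finType) (w' : I' -> R) h :
    is_law P0 w' h -> P0 [set` codom h] = 1%E.
  by move=> P0h; apply: (law_full P0h) => // i; exact: codom_f.
have sE : [set` s] = [set` codom x] `*` setT `&` setT `*` [set` codom y].
  apply/seteqP; split => [z /= /allpairsP[[a b] /= [xa yb ->]]|[a b] /=].
    by split.
  by move=> [[xa _] [_ yb]]; apply/allpairsP; exists (a, b).
have pis : pi [set` s] = 1%E.
  rewrite sE probability_full_setI//.
  - by rewrite pi1// (full _ _ _ _ P1x).
  - by apply: measurableX.
  - by apply: measurableX.
  - by rewrite pi2// (full _ _ _ _ P2y).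
have m1 (z : borel token * borel token) : measurable [set z].
  have -> : [set z] = [set z.1] `*` [set z.2].
    by apply/seteqP; case: z => a b; split => -[a' b'] /= [-> ->].
  by apply: measurableX; exact: token_set1.
have pil := finite_support_law pis m1.
exists (seq_sub s), (fun z => fine (pi [set val z])), (fun z => (val z).1),
  (fun z => (val z).2).
have sz (z : seq_sub s) : (val z).1 \in codom x /\ (val z).2 \in codom y.
  by have /allpairsP[[a b] /= [xa yb ->]] := valP z.
split.
- split => [z|A mA]; first exact: fine_ge0.
  rewrite -pi1// (pil.2 (A `*` setT)) ; last exact: measurableX.
  congr EFin; apply: eq_bigr => z _; congr (_ * _).
  by rewrite !indicE in_setX in_setT andbT.
- split => [z|A mA]; first exact: fine_ge0.
  rewrite -pi2// (pil.2 (setT `*` A)) ; last exact: measurableX.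
  congr EFin; apply: eq_bigr => z _; congr (_ * _).
  by rewrite !indicE in_setX in_setT.
- by move=> z; have [/codomP[i ->] _] := sz z.
- by move=> z; have [_ /codomP[i ->]] := sz z.
- rewrite -lte_fin; apply: le_lt_trans pir.
  rewrite (law_integral_ge0 pil)//=.
  + by rewrite -sumEFin.
  + by apply/measurable_EFinP; exact: measurable_cost.
  + by move=> z _; rewrite lee_fin cost_ge0.
Qed.

End transport_cost.

(** * Finite couplings *)

Section couplings.
Context (R : realType) (d : nat) (D : set (tokenT R d)).
Local Notation token := (tokenT R d).
Local Notation P := (probability (borel token) R).

(** The shared index set and weights are the coupling. The cost [c] is a parameter because mean
    distances and transport costs are combined. *)
Definition coupled (c : token -> token -> R) (P1 P2 : P) (e : R) :=
  exists (I : finType) (w : I -> R) (x y : I -> token),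
    [/\ is_law P1 w (x : I -> borel token), is_law P2 w (y : I -> borel token),
        forall i, D (x i), forall i, D (y i) & \sum_i w i * c (x i) (y i) <= e].

Lemma coupled_sym c P1 P2 e :
  coupled c P1 P2 e -> coupled (fun a b => c b a) P2 P1 e.
Proof. by move=> [I [w [x [y [P1x P2y Dx Dy ce]]]]]; exists I, w, y, x. Qed.

(** The weights sum to 1, so the additive constant [k] comes out of the average unchanged. *)
Lemma coupled_affine c c' P1 P2 e k L : 0 <= L ->
  (forall a b, D a -> D b -> c' a b <= k + L * c a b) ->
  coupled c P1 P2 e -> coupled c' P1 P2 (k + L * e).
Proof.
move=> L0 cc' [I [w [x [y [P1x P2y Dx Dy ce]]]]]; exists I, w, x, y; split => //.
rewrite (@le_trans _ _ (\sum_i w i * (k + L * c (x i) (y i))))//.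
  by apply: ler_sum => i _; rewrite ler_wpM2l ?cc'//; exact: P1x.1.
under eq_bigr do rewrite mulrDr.
rewrite big_split/= -mulr_suml (law_sum1 P1x) mul1r lerD2l.
under eq_bigr do rewrite mulrCA.
by rewrite -mulr_sumr ler_wpM2l.
Qed.

Lemma coupled_le c P1 P2 e e' : e <= e' ->
  coupled c P1 P2 e -> coupled c P1 P2 e'.
Proof.
move=> ee' [I [w [x [y [P1x P2y Dx Dy ce]]]]]; exists I, w, x, y; split => //.
exact: le_trans ee'.
Qed.

Lemma sum_marginal (I K : finType) (w : I -> R) (u : K -> R) (h : K -> I)
    (F : I -> R) :
  (forall i, \sum_(k | h k == i) u k = w i) ->
  \sum_k u k * F (h k) = \sum_i w i * F i.
Proof.
move=> uw; rewrite (partition_big h predT)//=; apply: eq_bigr => i _.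
by rewrite -uw mulr_suml; apply: eq_bigr => k /eqP ->.
Qed.

(** Gluing along the middle law. With three separate costs it yields both the triangle inequality
    and the effect on a transport cost of moving one end. *)
Lemma coupled_trans c1 c2 c3 P1 P2 P3 e1 e2 :
  (forall a m b, D a -> D m -> D b -> c3 a b <= c1 a m + c2 m b) ->
  coupled c1 P1 P2 e1 -> coupled c2 P2 P3 e2 -> coupled c3 P1 P3 (e1 + e2).
Proof.
move=> c123 [I [w [x [y [P1x P2y Dx Dy ce]]]]].
move=> [J [v [z [t [P2z P3t Dz Dt ce']]]]].
have [u [u0 uw uv uyz]] := glue (T := borel token) (@token_set1 R d) P2y P2z.
exists (I * J)%type, u, (fun k => x k.1), (fun k => t k.2); split => //.
- exact: (law_reindex (h := fst) P1x).
- exact: (law_reindex (h := snd) P3t).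
rewrite (le_trans _ (lerD ce ce'))// 
  -(sum_marginal (h := fst) (fun i => c1 (x i) (y i)) uw)
  -(sum_marginal (h := snd) (fun j => c2 (z j) (t j)) uv).
rewrite -big_split/=; apply: ler_sum => k _; rewrite -mulrDr.
(* Only pairs of positive weight matter, and for these the two middle points agree. *)
have [->|uk] := eqVneq (u k) 0; first by rewrite !mul0r.
by rewrite ler_wpM2l// (le_trans (c123 _ (y k.1) _ _ _ _))// {2}(uyz k uk).
Qed.

(** An upper bound on the W_1 distance for the sup norm on tokens, witnessed by a finite coupling
    supported in [D]. *)
Definition close := coupled (fun a b => `|a - b|).

Lemma close_sym P1 P2 e : close P1 P2 e -> close P2 P1 e.
Proof.
move=> /coupled_sym [I [w [x [y [P1x P2y Dx Dy ce]]]]]; exists I, w, x, y.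
by split => //; under eq_bigr do rewrite distrC.
Qed.

Lemma close_trans P1 P2 P3 e1 e2 :
  close P1 P2 e1 -> close P2 P3 e2 -> close P1 P3 (e1 + e2).
Proof. by apply: coupled_trans => a m b _ _ _; exact: ler_distD. Qed.

Section transport.
Variable lambda : R.
Hypothesis lambda_gt0 : 0 < lambda.

Lemma coupled_cost_W2 P1 P2 e :
  coupled (cost lambda) P1 P2 e -> (W2 lambda P1 P2 ^+ 2 <= e%:E)%E.
Proof.
move=> [I [w [x [y [P1x P2y Dx Dy ce]]]]].
by apply: (le_trans (W2_sqr_le lambda_gt0 P1x P2y)); rewrite lee_fin.
Qed.

Lemma W2_coupled_cost P1 P2 (I J : finType) (w : I -> R) (x : I -> token)
    (v : J -> R) (y : J -> token) r :
  is_law P1 w (x : I -> borel token) -> is_law P2 v (y : J -> borel token) ->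
  (forall i, D (x i)) -> (forall j, D (y j)) ->
  (W2 lambda P1 P2 ^+ 2 < r%:E)%E -> coupled (cost lambda) P1 P2 r.
Proof.
move=> P1x P2y Dx Dy /(W2_sqr_lt lambda_gt0 P1x P2y Dx Dy).
move=> [H [u [f [g [P1f P2g Df Dg /ltW cr]]]]].
by exists H, u, f, g.
Qed.

Hypothesis cD : compact D.

Lemma cost_almost_lipschitz e : 0 < e -> exists L, 0 <= L /\
  forall a b a' b', D a -> D b -> D a' -> D b' ->
    `|cost lambda a b - cost lambda a' b'| <= e + L * (`|a - a'| + `|b - b'|).
Proof.
move=> e0.
have [L [L0 hL]] := compact_almost_lipschitz (compact_setX cD cD)
  (@cost_continuous R d lambda) e0.
exists L; split => // a b a' b' Da Db Da' Db'.
have /= := hL (a, b) (a', b') (conj Da Db) (conj Da' Db').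
move=> /le_trans; apply; rewrite lerD2l ler_wpM2l// [leLHS]prod_normE/= ge_max.
by rewrite lerDl lerDr !normr_ge0.
Qed.

(** A nearly optimal coupling of [P2] and [Q2] is glued to the couplings of the two ends; each end
    changes the mean cost by at most [eta / 4 + L * delta <= eta / 2]. *)
Lemma W2_close eta : 0 < eta -> exists2 delta, 0 < delta &
  forall P1 P2 Q1 Q2, close P1 P2 delta -> close Q1 Q2 delta ->
    (W2 lambda P1 Q1 ^+ 2 <= W2 lambda P2 Q2 ^+ 2 + eta%:E)%E.
Proof.
move=> eta0; have e0 : 0 < eta / 4 by rewrite divr_gt0.
have [L [L0 hL]] := cost_almost_lipschitz e0.
have L10 : 0 < L + 1 by rewrite ltr_wpDl.
(* Dividing by [L + 1] rather than [L] allows [L = 0]; the same device recurs below. *)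
exists (eta / 4 / (L + 1)); first by rewrite divr_gt0.
set delta := eta / 4 / (L + 1) => P1 P2 Q1 Q2 c1 c2.
have Ld : eta / 4 + L * delta <= eta / 2.
  have : L * delta <= eta / 4.
    by rewrite /delta mulrA ler_pdivrMr// mulrC ler_wpM2l ?lerDl// ltW.
  by move=> h; rewrite (le_trans (lerD (lexx _) h))//; lra.
have [fW|] := boolP ((W2 lambda P2 Q2 ^+ 2)%E \is a fin_num); last first.
  rewrite ge0_fin_numE ?W2_sqr_ge0// -leNgt leye_eq => /eqP ->.
  by rewrite addye// leey.
(* The slack [e] pays for a coupling that is only nearly optimal. *)
apply/lee_addgt0Pr => e e1; set W := (W2 lambda P2 Q2 ^+ 2)%E in fW *.
have cW : coupled (cost lambda) P2 Q2 (fine W + e).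
  have [I [w [x [y [_ P2y _ Dy _]]]]] := c1.
  have [J [v [z [t [_ Q2t _ Dt _]]]]] := c2.
  apply: (W2_coupled_cost P2y Q2t Dy Dt).
  by rewrite -/W -{1}(fineK fW) lte_fin ltrDl.
have h1 : coupled (cost lambda) P1 Q2 (eta / 2 + (fine W + e)).
  apply: coupled_trans cW; last first.
    apply: coupled_le Ld _; apply: coupled_affine L0 _ c1 => a b Da Db.
    exact: lexx.
  move=> a m b Da Dm Db /=; rewrite -lerBlDr.
  rewrite (le_trans (ler_norm _))// (le_trans (hL _ _ _ _ Da Db Dm Db))//.
  by rewrite subrr normr0 addr0.
have h2 : coupled (cost lambda) P1 Q1 ((eta / 2 + (fine W + e)) + eta / 2).
  apply: coupled_trans h1 _; last first.
    apply: coupled_le Ld _.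
    by apply: coupled_affine L0 _ (close_sym c2) => a b Da Db; exact: lexx.
  move=> a m b Da Dm Db /=; rewrite -lerBlDl.
  rewrite (le_trans (ler_norm _))// (le_trans (hL _ _ _ _ Da Db Da Dm))//.
  by rewrite subrr normr0 add0r distrC.
apply: (le_trans (coupled_cost_W2 h2)).
rewrite -(fineK fW) -!EFinD lee_fin; lra.
Qed.

End transport.
End couplings.

(** * Quantization of measures *)

(** [r j] is the fraction of the mass of cell [j] that survives rounding down to a multiple of
    [1 / l]. Each cell loses at most [1 / l], and the total loss is again such a multiple because
    the total mass is 1. *)
Lemma grid_rounding (R : realType) (I J : finType) (w : I -> R) (k : I -> J)
    (l : nat) : (0 < l)%N -> (forall i, 0 <= w i) -> \sum_i w i = 1 ->
  exists r : J -> R, [/\ forall j, 0 <= r j <= 1,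
    forall j, exists a : nat, \sum_(i | k i == j) w i * r j = a%:R / l%:R,
    exists b : nat, \sum_i w i * (1 - r (k i)) = b%:R / l%:R &
    \sum_i w i * (1 - r (k i)) <= #|J|%:R / l%:R].
Proof.
move=> l0 w0 w1.
have lR : 0 < l%:R :> R by rewrite ltr0n.
pose W j := \sum_(i | k i == j) w i.
have W0 j : 0 <= W j by exact: sumr_ge0.
have lW0 j : 0 <= l%:R * W j by rewrite mulr_ge0// ltW.
pose a j := Num.truncn (l%:R * W j).
pose r j := if W j == 0 then 0 else (a j)%:R / l%:R / W j.
have a_le j : (a j)%:R / l%:R <= W j.
  by rewrite ler_pdivrMr// mulrC; have /andP[] := truncn_itv (lW0 j).
have a_gt j : W j - (a j)%:R / l%:R <= l%:R^-1.
  rewrite lerBlDl -[X in _ + X]mul1r -mulrDl ler_pdivlMr// mulrC natr1 ltW//.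
  by have /andP[] := truncn_itv (lW0 j).
have Wr j : W j * r j = (a j)%:R / l%:R.
  rewrite /r; case: eqP => [W0j|/eqP Wj]; last by rewrite mulrC divfK.
  by rewrite mulr0 /a W0j mulr0 truncn0 mul0r.
have sum1r : \sum_i w i * (1 - r (k i)) = \sum_j (W j - (a j)%:R / l%:R).
  rewrite (partition_big k predT)//=; apply: eq_bigr => j _.
  rewrite -Wr /W mulr_suml -sumrB; apply: eq_bigr => i /eqP ->.
  by rewrite mulrBr mulr1.
have sumW : \sum_j W j = 1.
  by rewrite -w1 [RHS](partition_big k predT).
exists r; split.
- move=> j; rewrite /r; case: eqP => [_|/eqP Wj]; first by rewrite lexx ler01.
  have Wj0 : 0 < W j by rewrite lt_def Wj W0.
  rewrite !mulr_ge0 ?invr_ge0 ?ler0n ?(ltW lR)//=.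
  by rewrite ler_pdivrMr// mul1r.
- by move=> j; exists (a j); rewrite -mulr_suml -Wr.
(* Makes the truncated subtraction below a true one. *)
- have sa : (\sum_j a j <= l)%N.
    rewrite -(ler_nat R) natr_sum.
    have -> : l%:R = \sum_j l%:R * W j by rewrite -mulr_sumr sumW mulr1.
    by apply: ler_sum => j _; have := a_le j; rewrite ler_pdivrMr// mulrC.
  exists (l - \sum_j a j)%N.
  rewrite sum1r sumrB sumW natrB// mulrBl divff ?gt_eqF//.
  by rewrite natr_sum mulr_suml.
- rewrite sum1r (@le_trans _ _ (\sum_(j : J) l%:R^-1))//; first exact: ler_sum.
  by rewrite sumr_const cardT -cardE mulr_natl.
Qed.

Section measure_quantization.
Context (R : realType) (N d : nat) (lambda : R).
Hypothesis lambda_gt0 : 0 < lambda.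
Local Notation token := (tokenT R d).
Local Notation P := (probability (borel token) R).

Lemma tokens_finite (S : set 'cV[R]_d) : finite_set S -> finite_set (tokens N S).
Proof. by move=> fS; apply: finite_setX => //; exact: finite_image. Qed.

Lemma tokens_sub (S S' : set 'cV[R]_d) :
  S `<=` S' -> tokens N S `<=` tokens N S'.
Proof. by move=> SS' z [z1 z2]; split => //; exact: SS'. Qed.

Lemma finite_probs_law (D : set token) (mu : P) : finite_set D ->
  probs (D : set (borel token)) mu ->
  exists (I : finType) (w : I -> R) (x : I -> token),
    is_law mu w (x : I -> borel token) /\ forall i, D (x i).
Proof.
move=> /finite_seqP[s ->] mus.
exists (seq_sub (s : seq (borel token))), (fun z => fine (mu [set val z])), val.
split; first by apply: finite_support_law => //; exact: token_set1.
by move=> z; exact: ssvalP.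
Qed.

Lemma W2_sqr_mono (P1 P2 Q1 Q2 : P) : (W2 lambda P1 P2 <= W2 lambda Q1 Q2)%E ->
  (W2 lambda P1 P2 ^+ 2 <= W2 lambda Q1 Q2 ^+ 2)%E.
Proof.
move=> h; rewrite -lee_sqrt ?W2_sqr_ge0// !sqrte_sqr !gee0_abs//.
- exact: sqrte_ge0.
- exact: sqrte_ge0.
Qed.

(** Every atom is split in two: the kept part moves to the representative of its cell, at cost at
    most [eta]; the rounding defect moves to one fixed atom, at cost at most [C]. *)
Lemma grid_approximation (D : set token) (mu : P) (I J : finType) (w : I -> R)
    (x : I -> token) (k : I -> J) (l : nat) (eta C : R) : (0 < l)%N ->
  measurable (D : set (borel token)) ->
  is_law mu w (x : I -> borel token) -> (forall i, D (x i)) ->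
  (forall i i', k i = k i' -> cost lambda (x i) (x i') <= eta) ->
  (forall i i', cost lambda (x i) (x i') <= C) ->
  exists2 nu, grid_probs l D nu &
    (W2 lambda mu nu ^+ 2 <= (eta + C * (#|J|%:R / l%:R))%:E)%E.
Proof.
move=> l0 mD mux Dx keta kC.
have [w0 _] := mux; have w1 := law_sum1 mux.
have [r [r01 /choice[a ra] [b rb] rJ]] := grid_rounding k l0 w0 w1.
have i0 := law_nonempty mux.
(* Empty cells get the default [i0]; they carry no mass. *)
pose rep j := odflt i0 [pick i | k i == j].
have krep i : k (rep (k i)) = k i.
  by rewrite /rep; case: pickP => [i' /eqP//|/(_ i)]; rewrite eqxx.
(* The boolean tells the kept part ([true]) from the defect ([false]). *)
pose u (z : I * bool) := w z.1 * (if z.2 then r (k z.1) else 1 - r (k z.1)).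
pose y (z : I * bool) := if z.2 then x (rep (k z.1)) else x i0.
have u0 z : 0 <= u z.
  rewrite mulr_ge0//; have /andP[? ?] := r01 (k z.1).
  by case: z.2; rewrite ?subr_ge0.
have sumE (F : I * bool -> R) :
    \sum_z F z = \sum_i F (i, true) + \sum_i F (i, false).
  rewrite -big_split/= (eq_bigr (fun z => F (z.1, z.2))); last by case.
  rewrite -(pair_bigA _ (fun i b => F (i, b)))/=; apply: eq_bigr => i _.
  by rewrite big_bool.
have uw i : \sum_(z | z.1 == i) u z = w i.
  rewrite big_mkcond sumE -!big_mkcond/= !big_pred1_eq /u/= -mulrDr.
  by rewrite addrC subrK mulr1.
have mu_u : is_law mu u ((x \o fst) : _ -> borel token).
  exact: (law_reindex (h := fst) mux).
have Dy z : D (y z) by rewrite /y; case: z.2.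
have [nu nuy] := law_exists (y : _ -> borel token) u0 (law_sum1 mu_u).
exists nu.
  split; first exact: (law_full nuy).
  move=> z Dz; have mz : measurable ([set z] : set (borel token)).
    exact: token_set1.
  rewrite (nuy.2 _ mz) sumE.
  have [a' ha] : exists a' : nat,
      \sum_i u (i, true) * \1_[set z] (y (i, true)) = a'%:R / l%:R.
    rewrite (partition_big k predT)//=.
    rewrite (eq_bigr (fun j =>
      \sum_(i | k i == j) w i * r j * \1_[set z] (x (rep j)))); last first.
      by move=> j _; apply: eq_bigr => i /eqP <-.
    under eq_bigr do rewrite -mulr_suml.
    (* Representatives of different cells may coincide, so the kept mass at [z] collects all cells
       represented there. *)
    exists (\sum_j (if x (rep j) == z then a j else 0))%N.
    rewrite natr_sum mulr_suml; apply: eq_bigr => j _.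
    rewrite ra indicE; case: eqP => [->|xz].
      by rewrite mem_set// mulr1.
    by rewrite memNset// mulr0 mul0r.
  have [c hc] : exists c : nat,
      \sum_i u (i, false) * \1_[set z] (y (i, false)) = c%:R / l%:R.
    rewrite /y/= -mulr_suml /u/= rb.
    exists (if x i0 == z then b else 0)%N; rewrite indicE; case: eqP => [->|xz].
      by rewrite mem_set// mulr1.
    by rewrite memNset// mulr0 mul0r.
  by exists (a' + c)%N; rewrite ha hc natrD mulrDl.
apply: (le_trans (W2_sqr_le lambda_gt0 mu_u nuy)); rewrite lee_fin sumE.
have C0 : 0 <= C by rewrite (le_trans _ (kC i0 i0))// cost_ge0.
apply: lerD.
  rewrite (@le_trans _ _ (\sum_i w i * eta))//; last first.
    by rewrite -mulr_suml w1 mul1r.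
  have eta0 : 0 <= eta.
    by rewrite (le_trans _ (keta i0 i0 erefl))// cost_ge0.
  apply: ler_sum => i _; rewrite /u/= -mulrA ler_wpM2l//.
  have /andP[r0 r1] := r01 (k i).
  by rewrite -[leRHS]mul1r ler_pM ?cost_ge0// keta.
rewrite (@le_trans _ _ (\sum_i w i * (1 - r (k i)) * C))//.
  by apply: ler_sum => i _; rewrite ler_wpM2l ?kC//.
by rewrite -mulr_suml mulrC ler_wpM2l.
Qed.

Variables (S : set 'cV[R]_d) (Sn : nat -> set 'cV[R]_d).
Hypothesis hSn : forall n, (0 < n)%N ->
  [/\ finite_set (Sn n), Sn n `<=` S &
      forall s, S s -> exists2 s', Sn n s' & frob (s - s') < n%:R^-1].
Variable Q : nat -> 'cV[R]_d -> 'cV[R]_d.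
Hypothesis hQ : forall n, (0 < n)%N -> nearest_point_map S (Sn n) (Q n).

Lemma nearest_point_dist n s : (0 < n)%N -> S s -> `|s - Q n s| <= n%:R^-1.
Proof.
move=> n0 Ss; have [_ _ /(_ s Ss)[s' Ss' /ltW ss']] := hSn n0.
apply: (le_trans (mx_norm_le_frob _)); apply: le_trans ss'.
by have [_ /(_ s Ss)[_]] := hQ n0; apply.
Qed.

Lemma quantize_dist n z : (0 < n)%N -> tokens N S z ->
  `|z - quantize (Q n) z| <= n%:R^-1.
Proof.
move=> n0 [_ z2]; rewrite prod_normE ge_max /= subrr normr0 invr_ge0 ler0n/=.
exact: nearest_point_dist.
Qed.

Lemma quantize_tokens n z : (0 < n)%N -> tokens N S z ->
  tokens N (Sn n) (quantize (Q n) z).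
Proof.
by move=> n0 [z1 z2]; split => //=; have [_ /(_ _ z2)[]] := hQ n0.
Qed.

Hypothesis cS : compact S.

Lemma tokens_compact : compact (tokens N S).
Proof.
apply: compact_setX => //; apply: finite_compact.
exact: finite_image.
Qed.

Lemma borel_tokens : measurable (tokens N S : set (borel token)).
Proof.
apply: borel_closed; apply: compact_closed tokens_compact.
exact: norm_hausdorff.
Qed.

Lemma borel_finite (D : set token) : finite_set D ->
  measurable (D : set (borel token)).
Proof.
move=> fD; apply: countable_measurable => [z|]; first exact: token_set1.
exact: finite_set_countable.
Qed.

Variable Rq : nat -> nat -> P -> P.
Hypothesis hRq : forall l n, (0 < l)%N -> (0 < n)%N ->
  measure_quantizer lambda l (tokens N (Sn n)) (Rq l n).

(** A closest grid measure does at least as well as the one from [grid_approximation], and a small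
    transport cost forces a small mean distance. The order of quantifiers matters: [l0] precedes
    [n]. *)
Lemma measure_quantizer_close e : 0 < e -> exists l0, forall l n (mu : P),
  (l0 <= l)%N -> (0 < l)%N -> (0 < n)%N ->
  probs (tokens N (Sn n) : set (borel token)) mu ->
  close (tokens N S) mu (Rq l n mu) e.
Proof.
move=> e0; have e20 : 0 < e / 2 by rewrite divr_gt0.
have [L [L0 hL]] := norm_le_cost d lambda_gt0 e20.
have L10 : 0 < L + 1 by rewrite ltr_wpDl.
pose eta := e / 2 / (L + 1); have eta0 : 0 < eta by rewrite divr_gt0.
have eta40 : 0 < eta / 4 by rewrite divr_gt0.
have [L' [L'0 hL']] := cost_almost_lipschitz lambda tokens_compact eta40.
have [C [C0 hC]] := compact_norm_bounded
  (compact_setX tokens_compact tokens_compact) (@cost_continuous R d lambda).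
(* Points of one cell share their nearest net point, so they lie within [2 / n0] of each other; this
   [n0] makes their cost at most [eta / 4 + eta / 4]. *)
pose n0 := (Num.truncn (2 * L' / (eta / 4))).+1.
have n0_0 : (0 < n0)%N by [].
have n0R : 0 < n0%:R :> R by rewrite ltr0n.
have hn0 : L' * (2 / n0%:R) <= eta / 4.
  have : 2 * L' / (eta / 4) < n0%:R.
    have /truncn_itv/andP[//] : 0 <= 2 * L' / (eta / 4).
    by apply: divr_ge0; [rewrite mulr_ge0|exact: ltW].
  rewrite ltr_pdivrMr// => /ltW h.
  by rewrite mulrA ler_pdivrMr// mulrC (mulrC _ n0%:R).
have [fSn0 Sn0S _] := hSn n0_0.
have /finite_seqP[s0 s0E] := tokens_finite fSn0.
(* The cells are indexed by the net Sn n0, so their number does not depend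
   on n; None is never reached. *)
pose J : finType := option (seq_sub (s0 : seq token)).
(* The defect then costs at most [eta / 4]. The total [3 / 4 * eta] stays strictly below [eta], as
   extracting a coupling requires. *)
pose l0 := (Num.truncn (C * #|J|%:R / (eta / 4))).+1.
have l0R : 0 < l0%:R :> R by rewrite ltr0n.
exists l0 => l n mu l0l l_gt0 n_gt0 muSn.
have lR : 0 < l%:R :> R by rewrite ltr0n.
have hl0 : C * (#|J|%:R / l%:R) <= eta / 4.
  have : C * #|J|%:R / (eta / 4) < l0%:R.
    have /truncn_itv/andP[//] : 0 <= C * #|J|%:R / (eta / 4).
    by apply: divr_ge0; [rewrite mulr_ge0|exact: ltW].
  rewrite ltr_pdivrMr// => /ltW h.
  rewrite mulrA ler_pdivrMr// (le_trans h)// mulrC.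
  by rewrite ler_pM2l// ler_nat.
have [fSn SnS _] := hSn n_gt0.
have SnX := tokens_sub SnS.
have fX := tokens_finite fSn.
have [I [w [x [mux Dx]]]] := finite_probs_law fX muSn.
pose k i : J := insub (quantize (Q n0) (x i)).
have k_eq i i' : k i = k i' -> quantize (Q n0) (x i) = quantize (Q n0) (x i').
  rewrite /k; case: insubP => [a _ <-|]; last first.
    have := quantize_tokens n0_0 (SnX _ (Dx i)); rewrite s0E /= => ->.
    by [].
  by case: insubP => [b _ <- [->]|].
have keta i i' : k i = k i' -> cost lambda (x i) (x i') <= eta / 2.
  move=> /k_eq kii'.
  have xx' : `|x i - x i'| <= 2 / n0%:R.
    rewrite (le_trans (ler_distD (quantize (Q n0) (x i)) _ _))//.
    rewrite mulr_natl mulr2n lerD//.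
      by apply: quantize_dist => //; exact: SnX.
    by rewrite kii' distrC; apply: quantize_dist => //; exact: SnX.
  have Xi := SnX _ (Dx i); have Xi' := SnX _ (Dx i').
  have := hL' _ _ _ _ Xi Xi' Xi Xi.
  rewrite cost_xx subr0 subrr normr0 add0r distrC => h.
  rewrite (le_trans (ler_norm _))// (le_trans h)//.
  have : L' * `|x i - x i'| <= eta / 4.
    by rewrite (le_trans _ hn0)// ler_wpM2l.
  by lra.
have kC i i' : cost lambda (x i) (x i') <= C.
  rewrite (le_trans (ler_norm _))//.
  by apply: (hC (x i, x i')); split; apply: SnX; exact: Dx.
have [nu nugrid munu] :=
  grid_approximation l_gt0 (borel_finite fX) mux Dx keta kC.
have [[Rgrid _] Rmin] := hRq l_gt0 n_gt0 muSn.
have [I' [w' [x' [Rx Dx']]]] := finite_probs_law fX Rgrid.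
have muR : (W2 lambda mu (Rq l n mu) ^+ 2 < eta%:E)%E.
  apply: (le_lt_trans (W2_sqr_mono (Rmin _ nugrid))).
  by apply: (le_lt_trans munu); rewrite lte_fin; lra.
have cc := W2_coupled_cost lambda_gt0 mux Rx (fun i => SnX _ (Dx i))
  (fun i => SnX _ (Dx' i)) muR.
have := coupled_affine L0 (fun a b _ _ => hL a b) cc.
apply: coupled_le.
have : L * eta <= e / 2.
  by rewrite /eta mulrA ler_pdivrMr// mulrC ler_wpM2l ?lerDl// ltW.
by move=> h; lra.
Qed.

End measure_quantization.

(** * The transformer layer *)

Section layer_continuity.
Context (R : realType) (N d d1 d2 : nat) (beta : R).
Context (sigma : 'cV[R]_d1 -> 'cV[R]_d1).
Hypothesis csigma : continuous sigma.
Local Notation token := (tokenT R d).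
Local Notation param := (paramT R d d1 d2).
Local Notation P := (probability (borel token) R).

(** Parameter and point form a single argument, so that one compactness argument gives a modulus in
    both. *)
Definition feed_forward (m : param * 'cV[R]_d) : 'cV[R]_d :=
  m.1.1.1.1.1.1 *m sigma (m.1.1.1.1.1.2 *m m.2 + m.1.1.1.1.2).

Definition kernel_weight (m : param * 'cV[R]_d * 'cV[R]_d) : R :=
  expR (beta * Defs.dotmx (m.1.1.1.1.2 *m m.1.2) (m.1.1.1.2 *m m.2)).

Definition kernel_value (m : param * 'cV[R]_d * 'cV[R]_d) : 'cV[R]_d :=
  kernel_weight m *: (m.1.1.2 *m m.2).

Let cid (X : topologicalType) : continuous (fun x : X => x).
Proof. by move=> x; exact: cvg_id. Qed.

Lemma feed_forward_continuous : continuous feed_forward.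
Proof.
apply: continuous_mulmx; first by do 6 apply: continuous_fst; exact: cid.
apply: (continuous_compose csigma) => x; apply: cvgD; last first.
  by move: x; apply: continuous_snd; do 4 apply: continuous_fst; exact: cid.
move: x; apply: continuous_mulmx; last by apply: continuous_snd; exact: cid.
by apply: continuous_snd; do 5 apply: continuous_fst; exact: cid.
Qed.

Let exponent_continuous : continuous
  (fun m : param * 'cV[R]_d * 'cV[R]_d =>
    beta * Defs.dotmx (m.1.1.1.1.2 *m m.1.2) (m.1.1.1.2 *m m.2)).
Proof.
move=> x; apply: cvgM; first exact: cvg_cst.
move: x; apply: continuous_dotmx; apply: continuous_mulmx.
- by apply: continuous_snd; do 4 apply: continuous_fst; exact: cid.
- by apply: continuous_snd; apply: continuous_fst; exact: cid.
- by apply: continuous_snd; do 3 apply: continuous_fst; exact: cid.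
- by apply: continuous_snd; exact: cid.
Qed.

Lemma kernel_weight_continuous : continuous kernel_weight.
Proof.
by apply: (continuous_compose (@continuous_expR R)); exact: exponent_continuous.
Qed.

Lemma kernel_value_continuous : continuous kernel_value.
Proof.
move=> x; apply: cvgZ; first exact: kernel_weight_continuous.
move: x; apply: continuous_mulmx; last by apply: continuous_snd; exact: cid.
by apply: continuous_snd; do 2 apply: continuous_fst; exact: cid.
Qed.

Lemma kernel_weight_gt0 m : 0 < kernel_weight m.
Proof. exact: expR_gt0. Qed.

(** The inverse weight is continuous, hence bounded on a compact set. Attention denominators are
    averages of weights and inherit the lower bound. *)
Lemma kernel_weight_inv_bounded (K : set (param * 'cV[R]_d * 'cV[R]_d)) :
  compact K -> exists2 B, 0 < B & forall m, K m -> B^-1 <= kernel_weight m.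
Proof.
move=> cK.
have cV : continuous (fun m => (kernel_weight m)^-1).
  move=> x; apply: cvgV; last exact: kernel_weight_continuous.
  by rewrite gt_eqF// kernel_weight_gt0.
have [B [B0 hB]] := compact_norm_bounded (V := R^o) cK cV.
have B1 : 0 < B + 1 by rewrite ltr_wpDl.
exists (B + 1) => // m Km; have := hB _ Km.
have k0 := kernel_weight_gt0 m.
rewrite ger0_norm ?invr_ge0 ?(ltW k0)// => h.
rewrite -[leRHS]invrK lef_pV2 ?posrE ?invr_gt0//.
by rewrite (le_trans h)// lerDl.
Qed.

(** Attention as a function of atoms and weights: two coupled laws then differ only in their
    atoms. *)
Definition law_attention (U : param) (x : 'cV[R]_d) (I : finType) (w : I -> R)
    (y : I -> 'cV[R]_d) : 'cV[R]_d :=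
  (\sum_i w i * kernel_weight (U, x, y i))^-1 *:
  \sum_i w i *: kernel_value (U, x, y i).

Definition law_layer (z : token) (U : param) (I : finType) (w : I -> R)
    (y : I -> 'cV[R]_d) : token :=
  (z.1, feed_forward (U, z.2) + law_attention U z.2 w y).

Lemma sum_kernel_weight_gt0 U x (I : finType) (w : I -> R) y :
  (forall i, 0 <= w i) -> \sum_i w i = 1 ->
  0 < \sum_i w i * kernel_weight (U, x, y i).
Proof.
move=> w0 w1; rewrite lt_def sumr_ge0 ?andbT; last first.
  by move=> i _; rewrite mulr_ge0// ltW// kernel_weight_gt0.
apply/eqP => /eqP; rewrite psumr_eq0 => [/allP k0|i _]; last first.
  by rewrite mulr_ge0// ltW// kernel_weight_gt0.
have := oner_neq0 R; rewrite -w1 big1 ?eqxx// => i _.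
have := k0 i; rewrite mem_index_enum => /(_ isT)/=.
by rewrite mulf_eq0 (gt_eqF (kernel_weight_gt0 _)) orbF => /eqP.
Qed.

Lemma law_layer_continuous U (I : finType) (w : I -> R) y :
  (forall i, 0 <= w i) -> \sum_i w i = 1 ->
  continuous (fun z => law_layer z U w y).
Proof.
move=> w0 w1.
have cUx (t : 'cV[R]_d) : continuous (fun z : token => (U, z.2, t)).
  apply: continuous_pair => [|x]; last exact: cvg_cst.
  by apply: continuous_pair => x; [exact: cvg_cst|exact: cvg_snd].
apply: continuous_pair => x; first exact: cvg_fst.
apply: cvgD.
  apply: (continuous_compose feed_forward_continuous).
  by apply: continuous_pair => {}x; [exact: cvg_cst|exact: cvg_snd].
apply: cvgZ.
  apply: cvgV; first by rewrite gt_eqF// sum_kernel_weight_gt0.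
  move: x; apply: (@continuous_sum R _ R^o) => i x.
  apply: cvgM; first exact: cvg_cst.
  exact: (continuous_compose kernel_weight_continuous (cUx _)).
move: x; apply: continuous_sum => i x; apply: cvgZ; first exact: cvg_cst.
exact: (continuous_compose kernel_value_continuous (cUx _)).
Qed.

Section compact_space.
Variables (S : set 'cV[R]_d) (UU : set param).
Hypotheses (cS : compact S) (cUU : compact UU).

Lemma layer_lawE (mu : P) (I : finType) (w : I -> R) (x : I -> token) z U :
  is_law mu w (x : I -> borel token) -> (forall i, tokens N S (x i)) ->
  layer N beta sigma S z U mu = law_layer z U w (fun i => (x i).2).
Proof.
move=> mux Dx; case: U => [[[[[W A] b] q] k] v].
rewrite /layer /law_layer; congr (_, _ + _).
have mS : measurable (S : set (borel 'cV[R]_d)).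
  by apply: borel_closed; apply: compact_closed cS; exact: norm_hausdorff.
have mufx : is_law (feature_marginal N S mu) w
    (fun i => (x i).2 : borel 'cV[R]_d).
  apply: (law_push mux) => //; first exact: borel_tokens.
  by apply: measurable_funTS; apply: borel_continuous => t; exact: cvg_snd.
have Sx i : S (x i).2 by have [] := Dx i.
pose U : param := (W, A, b, q, k, v).
have ctt (t : 'cV[R]_d) : continuous (fun u : 'cV[R]_d => (U, t, u)).
  by apply: continuous_pair => [|u]; [exact: cst_continuous|exact: cvg_id].
have mweight t : measurable_fun (S : set (borel 'cV[R]_d))
    (fun u => kernel_weight (U, t, u)).
  apply: measurable_funTS; apply: borel_continuous_real.
  exact: (continuous_compose kernel_weight_continuous (ctt _)).
rewrite /attention /law_attention; congr (_^-1 *: _).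
  exact: (law_Rintegral mufx mS (mweight z.2) Sx).
apply/colP => i; rewrite mxE summxE.
pose g u := kernel_weight (U, z.2, u) * (v *m u) i ord0.
have mg : measurable_fun (S : set (borel 'cV[R]_d)) g.
  apply: measurable_funM; first exact: (mweight z.2).
  apply: measurable_funTS; apply: borel_continuous_real.
  apply: continuous_entry; apply: continuous_mulmx => u; last exact: cvg_id.
  exact: cst_continuous.
apply: (etrans (law_Rintegral mufx mS mg Sx)).
by apply: eq_bigr => j _; rewrite mxE [in RHS]mxE.
Qed.

End compact_space.
End layer_continuity.

(** * Moduli of continuity of attention and of the layer *)

Lemma weighted_average_dist (R : realType) (V : normedModType R) (B G a a' : R)
    (v v' : V) : 0 < B -> B^-1 <= a -> B^-1 <= a' -> `|v'| <= G ->
  `|a^-1 *: v - a'^-1 *: v'| <= B * `|v - v'| + B ^+ 2 * G * `|a - a'|.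
Proof.
move=> B0 aB a'B v'G.
have a0 : 0 < a by rewrite (lt_le_trans _ aB)// invr_gt0.
have a'0 : 0 < a' by rewrite (lt_le_trans _ a'B)// invr_gt0.
have inv t : 0 < t -> B^-1 <= t -> t^-1 <= B.
  by move=> t0 Bt; rewrite -[B]invrK lef_pV2 ?posrE ?invr_gt0.
have -> : a^-1 *: v - a'^-1 *: v' = a^-1 *: (v - v') + (a^-1 - a'^-1) *: v'.
  by rewrite scalerBr scalerBl addrA subrK.
rewrite (le_trans (ler_normD _ _))// !normrZ; apply: lerD.
  by rewrite ler_wpM2r// gtr0_norm ?invr_gt0// inv.
have -> : a^-1 - a'^-1 = a^-1 * a'^-1 * (a' - a).
  by field; rewrite !gt_eqF.
have pos (t : R) : 0 < t -> `|t^-1| = t^-1.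
  by move=> t0; rewrite gtr0_norm ?invr_gt0.
rewrite !normrM distrC (pos a)// (pos a')// mulrAC ler_wpM2r//.
rewrite expr2 ler_pM ?mulr_ge0 ?invr_ge0 ?(ltW a0) ?(ltW a'0)//.
by rewrite ler_pM ?invr_ge0 ?(ltW a0) ?(ltW a'0)// inv.
Qed.

Lemma dist_sum_le (R : realType) (V : normedModType R) (I : finType)
    (w : I -> R) (f g : I -> V) (e L D : R) (h : I -> R) :
  (forall i, 0 <= w i) -> \sum_i w i = 1 ->
  (forall i, `|f i - g i| <= e + L * (D + h i)) ->
  `|\sum_i w i *: f i - \sum_i w i *: g i| <= e + L * (D + \sum_i w i * h i).
Proof.
move=> w0 w1 fg; rewrite -sumrB (le_trans (ler_norm_sum _ _ _))//.
rewrite (@le_trans _ _ (\sum_i w i * (e + L * (D + h i))))//.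
  apply: ler_sum => i _; rewrite -scalerBr normrZ ger0_norm//.
  by rewrite ler_wpM2l.
under eq_bigr do rewrite mulrDr mulrCA (mulrDr (w _)).
rewrite big_split/= -mulr_suml w1 mul1r -mulr_sumr big_split/= -mulr_suml w1.
by rewrite mul1r.
Qed.

Section layer_modulus.
Context (R : realType) (N d d1 d2 : nat) (beta : R).
Context (sigma : 'cV[R]_d1 -> 'cV[R]_d1).
Hypothesis csigma : continuous sigma.
Local Notation token := (tokenT R d).
Local Notation param := (paramT R d d1 d2).
Local Notation P := (probability (borel token) R).
Variables (S : set 'cV[R]_d) (UU : set param).
Hypotheses (cS : compact S) (cUU : compact UU).

(** Numerator and denominator are averages of continuous functions on a compact set, and the
    denominator is at least [B^-1]. Hence [L] is chosen before the index set, the weights and the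
    atoms. *)
Lemma law_attention_almost_lipschitz e : 0 < e -> exists L, 0 <= L /\
  forall (U U' : param) x x' (I : finType) (w : I -> R) y y',
    UU U -> UU U' -> S x -> S x' -> (forall i, 0 <= w i) -> \sum_i w i = 1 ->
    (forall i, S (y i)) -> (forall i, S (y' i)) ->
    `|law_attention beta U x w y - law_attention beta U' x' w y'| <=
      e + L * (`|U - U'| + `|x - x'| + \sum_i w i * `|y i - y' i|).
Proof.
move=> e0.
have cK := compact_setX (compact_setX cUU cS) cS.
have [B B0 hB] := kernel_weight_inv_bounded beta cK.
have [G [G0 hG]] := compact_norm_bounded cK
  (@kernel_value_continuous R d d1 d2 beta).
(* The quotient estimate multiplies the error of the numerator by [B] and that of the denominator by
   [B ^+ 2 * (G + 1)]; the tolerances below undo this, leaving [e / 2] each. Taking [G + 1] keeps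
   the factor positive. *)
have C0 : 0 < B ^+ 2 * (G + 1) by rewrite mulr_gt0 ?exprn_gt0// ltr_wpDl.
have e20 : 0 < e / 2 / B by rewrite !divr_gt0.
have e30 : 0 < e / 2 / (B ^+ 2 * (G + 1)) by rewrite divr_gt0 ?divr_gt0.
have [L2 [L20 hL2]] := compact_almost_lipschitz cK
  (@kernel_value_continuous R d d1 d2 beta) e20.
have [L3 [L30 hL3]] := compact_almost_lipschitz (V := R^o) cK
  (@kernel_weight_continuous R d d1 d2 beta) e30.
exists (B * L2 + B ^+ 2 * (G + 1) * L3); split.
  by rewrite addr_ge0// mulr_ge0// ltW.
move=> U U' x x' I w y y' Uu Uu' Sx Sx' w0 w1 Sy Sy'.
set Delta := _ + \sum_i _.
have den u t (z : I -> _) : UU u -> S t -> (forall i, S (z i)) ->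
    B^-1 <= \sum_i w i * kernel_weight beta (u, t, z i).
  move=> Uu0 St Sz; rewrite -[B^-1]mul1r -w1 mulr_suml; apply: ler_sum => i _.
  by rewrite ler_wpM2l//; apply: hB; do 2 split => //=.
have dist3 i : `|(U, x, y i) - (U', x', y' i)| <=
    `|U - U'| + `|x - x'| + `|y i - y' i|.
  rewrite [leLHS]prod_normE/= ge_max lerDr addr_ge0//= andbT.
  rewrite [leLHS]prod_normE/= ge_max.
  by rewrite -!addrA lerDl addr_ge0//= addrCA lerDl addr_ge0.
have num : `|\sum_i w i *: kernel_value beta (U, x, y i)
    - \sum_i w i *: kernel_value beta (U', x', y' i)| <= e / 2 / B + L2 * Delta.
  apply: dist_sum_le => // i.
  apply: le_trans (hL2 _ _ _ _) _; [by do 2 split => //=|by do 2 split => //=|].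
  by rewrite lerD2l ler_wpM2l.
have deno : `|\sum_i w i * kernel_weight beta (U, x, y i)
    - \sum_i w i * kernel_weight beta (U', x', y' i)| <=
    e / 2 / (B ^+ 2 * (G + 1)) + L3 * Delta.
  apply: (@dist_sum_le _ R^o) => // i.
  apply: le_trans (hL3 _ _ _ _) _; [by do 2 split => //=|by do 2 split => //=|].
  by rewrite lerD2l ler_wpM2l.
have numG : `|\sum_i w i *: kernel_value beta (U', x', y' i)| <= G + 1.
  rewrite (@le_trans _ _ G)//; last by rewrite lerDl.
  rewrite (le_trans (ler_norm_sum _ _ _))// -[leRHS]mul1r -w1 mulr_suml.
  apply: ler_sum => i _; rewrite normrZ ger0_norm// ler_wpM2l//.
  by apply: hG; do 2 split => //=.
have := weighted_average_dist
  (\sum_i w i *: kernel_value beta (U, x, y i)) B0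
  (den _ _ _ Uu Sx Sy) (den _ _ _ Uu' Sx' Sy') numG.
move=> /le_trans; apply.
rewrite (le_trans (lerD (ler_wpM2l (ltW B0) num) (ler_wpM2l (ltW C0) deno)))//.
have BN : B != 0 by rewrite gt_eqF.
have := lt0r_neq0 C0; move: (B ^+ 2 * (G + 1)) => C CN.
by rewrite le_eqVlt; apply/orP; left; apply/eqP; field; rewrite BN CN.
Qed.

Lemma law_layer_almost_lipschitz e : 0 < e -> exists L, 0 <= L /\
  forall (U U' : param) (z z' : token) (I : finType) (w : I -> R)
      (x x' : I -> token),
    UU U -> UU U' -> S z.2 -> S z'.2 ->
    (forall i, 0 <= w i) -> \sum_i w i = 1 ->
    (forall i, S (x i).2) -> (forall i, S (x' i).2) ->
    `|law_layer beta sigma z U w (fun i => (x i).2)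
      - law_layer beta sigma z' U' w (fun i => (x' i).2)| <=
      e + L * (`|U - U'| + `|z - z'| + \sum_i w i * `|x i - x' i|).
Proof.
move=> e0; have e20 : 0 < e / 2 by rewrite divr_gt0.
have [L1 [L10 hL1]] := law_attention_almost_lipschitz e20.
have [L2 [L20 hL2]] := compact_almost_lipschitz (compact_setX cUU cS)
  (@feed_forward_continuous R d d1 d2 sigma csigma) e20.
(* The summand 1 serves the position coordinate, which the layer copies. *)
exists (L1 + L2 + 1); split; first by rewrite !addr_ge0.
move=> U U' z z' I w x x' Uu Uu' Sz Sz' w0 w1 Sx Sx'.
set Delta := `|U - U'| + `|z - z'| + _.
have zz' : `|z.2 - z'.2| <= `|z - z'|.
  by rewrite [leRHS]prod_normE/= le_max lexx orbT.
have s0 : 0 <= \sum_i w i * `|x i - x' i|.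
  by apply: sumr_ge0 => i _; rewrite mulr_ge0.
have zD : `|z - z'| <= Delta by rewrite /Delta addrAC lerDr addr_ge0.
have D0 : 0 <= Delta by rewrite (le_trans _ zD).
have att : `|law_attention beta U z.2 w (fun i => (x i).2)
    - law_attention beta U' z'.2 w (fun i => (x' i).2)| <= e / 2 + L1 * Delta.
  rewrite (le_trans (hL1 _ _ _ _ _ _ _ _ Uu Uu' Sz Sz' w0 w1 Sx Sx'))//.
  rewrite lerD2l ler_wpM2l// /Delta lerD ?lerD//.
  apply: ler_sum => i _; rewrite ler_wpM2l// [leRHS]prod_normE/= le_max.
  by rewrite lexx orbT.
have ff : `|feed_forward sigma (U, z.2) - feed_forward sigma (U', z'.2)| <=
    e / 2 + L2 * Delta.
  apply: le_trans (hL2 _ _ _ _) _; [by split|by split|].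
  rewrite lerD2l ler_wpM2l// [leLHS]prod_normE/= ge_max /Delta.
  by rewrite -addrA lerDl addr_ge0//= addrCA (le_trans zz')// lerDl addr_ge0.
rewrite [leLHS]prod_normE/= ge_max; apply/andP; split.
  have : `|z.1 - z'.1| <= Delta.
    by rewrite (le_trans _ zD)// [leRHS]prod_normE/= le_max lexx.
  move=> /le_trans; apply.
  rewrite mulrDl mul1r addrA lerDr; apply: addr_ge0; first exact: ltW.
  by rewrite mulr_ge0// addr_ge0.
rewrite opprD addrACA (le_trans (ler_normD _ _))// (le_trans (lerD ff att))//.
rewrite !mulrDl mul1r.
have : 0 <= L1 * Delta by rewrite mulr_ge0.
by lra.
Qed.

Hypothesis hlayer : forall z U (mu : P),
  tokens N S z -> UU U -> probs (tokens N S : set (borel token)) mu ->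
  tokens N S (layer N beta sigma S z U mu).

Let mD : measurable (tokens N S : set (borel token)) := borel_tokens N cS.

Lemma law_layer_tokens (mu : P) (I : finType) (w : I -> R) (x : I -> token)
    (U : param) z :
  is_law mu w (x : I -> borel token) -> (forall i, tokens N S (x i)) -> UU U ->
  tokens N S z -> tokens N S (law_layer beta sigma z U w (fun i => (x i).2)).
Proof.
move=> mux Dx Uu Dz; rewrite -(layer_lawE beta sigma cS z U mux Dx).
by apply: hlayer => //; exact: (law_full mux mD Dx).
Qed.

Lemma measurable_layer (mu : P) (I : finType) (w : I -> R) (x : I -> token)
    (U : param) :
  is_law mu w (x : I -> borel token) -> (forall i, tokens N S (x i)) ->
  measurable_fun (tokens N S : set (borel token))
    ((fun z => layer N beta sigma S z U mu) : borel token -> borel token).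
Proof.
move=> mux Dx; apply: measurable_funTS; apply: borel_continuous.
under eq_fun do rewrite (layer_lawE beta sigma cS _ U mux Dx).
exact: (law_layer_continuous csigma mux.1 (law_sum1 mux)).
Qed.

Lemma Phi_law (mu : P) (I : finType) (w : I -> R) (x : I -> token)
    (U : param) :
  is_law mu w (x : I -> borel token) -> (forall i, tokens N S (x i)) ->
  is_law (Phi N beta sigma S mu U) w
    ((fun i => law_layer beta sigma (x i) U w (fun j => (x j).2)) :
       I -> borel token).
Proof.
move=> mux Dx; have := law_push mux mD (measurable_layer U mux Dx) Dx.
congr (is_law _ _ _); apply/funext => i /=.
by rewrite (layer_lawE beta sigma cS _ U mux Dx).
Qed.

(** On tokens the image is finite, so every preimage is a finite union of measurable rectangles, one
    for each value in [B]. *)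
Lemma measurable_quantize (Sn : set 'cV[R]_d) (q : 'cV[R]_d -> 'cV[R]_d) :
  finite_set Sn -> nearest_point_map S Sn q ->
  measurable_fun (tokens N S : set (borel token))
    (quantize q : borel token -> borel token).
Proof.
move=> fSn [mq qSn] _ B mB.
have mS : measurable (S : set (borel 'cV[R]_d)).
  by apply: borel_closed; apply: compact_closed cS; exact: norm_hausdorff.
have -> : tokens N S `&` quantize q @^-1` B =
    \bigcup_(t in tokens N Sn `&` B) (tokens N S `&`
      ((fst @^-1` [set t.1]) `&` (snd @^-1` (S `&` q @^-1` [set t.2])))).
  apply/seteqP; split => [z [[z1 z2] Bz]|z [t [_ Bt] [Dz [/= z1 [_ z2]]]]].
    by exists (quantize q z) => //; split => //; split => //; exact: (qSn _ z2).1.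
  by split => //; rewrite /= /quantize z1 z2; case: t Bt {z1 z2}.
apply: fin_bigcup_measurable => [|t _].
  by apply: finite_setIl; exact: tokens_finite.
apply: measurableI => //; apply: measurableI.
  have : measurable_fun setT (fst : borel token -> R).
    by apply: borel_continuous_real => z; exact: cvg_fst.
  by move=> /(_ measurableT [set t.1] (measurable_set1 _)); rewrite setTI.
have : measurable_fun setT (snd : borel token -> borel 'cV[R]_d).
  by apply: borel_continuous => z; exact: cvg_snd.
move=> /(_ measurableT (S `&` q @^-1` [set t.2])); rewrite setTI; apply.
by apply: mq => //; apply: borel_set1; exact: norm_hausdorff.
Qed.

Lemma Phi_quantized_law (Sn : set 'cV[R]_d) (q : 'cV[R]_d -> 'cV[R]_d)
    (mu : P) (I : finType) (w : I -> R) (x : I -> token)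
    (U : param) :
  finite_set Sn -> nearest_point_map S Sn q ->
  is_law mu w (x : I -> borel token) -> (forall i, tokens N S (x i)) -> UU U ->
  is_law (Phi_quantized N beta sigma S q mu U) w
    ((fun i => quantize q (law_layer beta sigma (x i) U w (fun j => (x j).2))) :
       I -> borel token).
Proof.
move=> fSn nq mux Dx Uu.
have mqf : measurable_fun (tokens N S : set (borel token))
    ((fun z => quantize q (layer N beta sigma S z U mu)) :
       borel token -> borel token).
  apply: (@measurable_comp _ _ _ _ _ _ (tokens N S : set (borel token))
    (quantize q : borel token -> borel token)) => //.
  - move=> _ [z Dz <-]; apply: hlayer => //; exact: (law_full mux mD Dx).
  - exact: measurable_quantize nq.
  - exact: measurable_layer mux Dx.
have := law_push mux mD mqf Dx.
congr (is_law _ _ _); apply/funext => i /=.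
by rewrite (layer_lawE beta sigma cS _ U mux Dx).
Qed.

End layer_modulus.

(** * Error bounds and terminal costs *)

(** [good l n m e] reads: [e] is an admissible error. The infimum of these is taken; the second
    hypothesis makes it admissible too, and the last one makes it tend to 0. *)
Lemma exists_vanishing_error (R : realType)
    (good : nat -> nat -> nat -> R -> Prop) (ell : nat -> nat) :
  (forall l n m, exists2 e, 0 <= e & good l n m e) ->
  (forall l n m e, (forall e', 0 < e' -> good l n m (e + e')) -> good l n m e) ->
  (forall l n m e e', e <= e' -> good l n m e -> good l n m e') ->
  (forall eta, 0 < eta -> exists n0, forall l n m,
     (n0 <= l)%N -> (n0 <= n)%N -> (n0 <= m)%N -> good l n m eta) ->
  exists eps : nat -> nat -> nat -> R,
    [/\ forall l n m, 0 <= eps l n m,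
        eps z.1.1 z.1.2 z.2 @[z --> filter_prod (filter_prod \oo \oo) \oo]
          --> (0 : R),
        ell n @[n --> \oo] --> \oo ->
          eps (ell z.1) z.1 z.2 @[z --> filter_prod \oo \oo] --> (0 : R) &
        forall l n m, good l n m (eps l n m)].
Proof.
move=> g_ex g_closed g_mono g_lim.
pose E l n m := [set e | 0 <= e /\ good l n m e].
have lbE l n m : lbound (E l n m) 0 by move=> e [].
have E0 l n m : E l n m !=set0 by have [e e0 ge] := g_ex l n m; exists e.
have iE l n m : has_inf (E l n m) by split; [exact: E0|exists 0; exact: lbE].
pose eps l n m := inf (E l n m).
have eps0 l n m : 0 <= eps l n m by apply: lb_le_inf; [exact: E0|exact: lbE].
have eps_le l n m e : 0 <= e -> good l n m e -> eps l n m <= e.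
  by move=> e0 ge; apply: ge_inf; [exists 0; exact: lbE|split].
exists eps; split=> //.
- apply/cvgrPdist_le => e e0; have [n0 hn0] := g_lim _ e0.
  have nn0 : \oo [set n | (n0 <= n)%N] by exists n0.
  exists ([set z | (n0 <= z.1)%N /\ (n0 <= z.2)%N], [set n | (n0 <= n)%N]).
    by split => //; exists ([set n | (n0 <= n)%N], [set n | (n0 <= n)%N]).
  move=> [[l n] m] /= [[ln nn] mn].
  rewrite sub0r normrN ger0_norm//.
  by apply: eps_le; [exact: ltW|exact: hn0].
- move=> ell_oo; apply/cvgrPdist_le => e e0; have [n0 hn0] := g_lim _ e0.
  have nn0 : \oo [set n | (n0 <= n)%N] by exists n0.
  exists ([set n | (n0 <= ell n)%N] `&` [set n | (n0 <= n)%N],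
          [set n | (n0 <= n)%N]).
    by split => //; apply: filterI => //; exact: (ell_oo _ nn0).
  move=> [n m] /= [[ln nn] mn].
  rewrite sub0r normrN ger0_norm//.
  by apply: eps_le; [exact: ltW|exact: hn0].
- move=> l n m; apply: g_closed => e' e'0.
  have [e [_ ge] /ltW ee'] := inf_adherent e'0 (iE l n m).
  exact: g_mono ee' ge.
Qed.

Lemma norm_le_param_norm (R : realType) (d d1 d2 : nat) (U : paramT R d d1 d2) :
  `|U| <= param_norm U.
Proof.
case: U => [[[[[W A] b] q] k] v].
have frob2 m n (M : 'M[R]_(m, n)) : 0 <= frob M ^+ 2 by exact: sqr_ge0.
have le_sqrt m n (M : 'M[R]_(m, n)) s : frob M ^+ 2 <= s -> `|M| <= Num.sqrt s.
  move=> Ms; rewrite (le_trans (mx_norm_le_frob _))//.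
  by rewrite -(ger0_norm (frob_ge0 M)) -sqrtr_sqr ler_wsqrtr.
rewrite /param_norm !prod_normE/= !ge_max -!andbA.
have := frob2 _ _ W; have := frob2 _ _ A; have := frob2 _ _ b.
have := frob2 _ _ q; have := frob2 _ _ k; have := frob2 _ _ v.
by move=> ? ? ? ? ? ?; apply/and5P; split; [| | | |apply/andP; split];
  apply: le_sqrt; lra.
Qed.

Section terminal_costs.
Context (R : realType) (d K : nat) (lambda : R).
Hypotheses (K_gt0 : (0 < K)%N) (lambda_gt0 : 0 < lambda).
Local Notation P := (probability (borel (tokenT R d)) R).
Implicit Types mu nu : 'I_K -> P.

Lemma terminal_cost_ge0 mu nu : (0 <= terminal_cost lambda nu mu)%E.
Proof.
rewrite /terminal_cost mule_ge0// ?lee_fin ?invr_ge0//.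
by apply: sume_ge0 => k _; exact: W2_sqr_ge0.
Qed.

Let average_cst (eta : R) :
  ((K%:R^-1)%:E * \sum_(k < K) eta%:E = eta%:E)%E.
Proof.
rewrite sumEFin sumr_const card_ord -EFinM -[eta *+ K]mulr_natl mulKf//.
by rewrite pnatr_eq0 -lt0n.
Qed.

Lemma terminal_cost_le mu nu mu' nu' eta : 0 <= eta ->
  (forall k, (W2 lambda (mu k) (nu k) ^+ 2
     <= W2 lambda (mu' k) (nu' k) ^+ 2 + eta%:E)%E) ->
  (terminal_cost lambda nu mu <= terminal_cost lambda nu' mu' + eta%:E)%E.
Proof.
move=> eta0 h; rewrite -[X in (_ + X)%E](average_cst eta) /terminal_cost.
rewrite -ge0_muleDr; last 2 first.
- by apply: sume_ge0 => k _; exact: W2_sqr_ge0.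
- by apply: sume_ge0 => k _; rewrite lee_fin.
rewrite -big_split/=; apply: lee_wpmul2l; first by rewrite lee_fin invr_ge0.
by apply: lee_sum => k _; exact: h.
Qed.

Lemma terminal_cost_bounded mu nu C :
  (forall k, (W2 lambda (mu k) (nu k) ^+ 2 <= C%:E)%E) ->
  (terminal_cost lambda nu mu <= C%:E)%E.
Proof.
move=> h; rewrite -(average_cst C) /terminal_cost.
apply: lee_wpmul2l; first by rewrite lee_fin invr_ge0.
by apply: lee_sum => k _; exact: h.
Qed.

End terminal_costs.

Definition finitely_supported (R : realType) d (D : set (tokenT R d))
    (mu : probability (borel (tokenT R d)) R) :=
  exists (I : finType) (w : I -> R) (x : I -> tokenT R d),
    is_law mu w (x : I -> borel (tokenT R d)) /\ forall i, D (x i).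

(** The independent coupling already costs no more than the maximum of the cost on the compact
    set. *)
Lemma W2_sqr_bounded (R : realType) d (D : set (tokenT R d)) (lambda : R) :
  0 < lambda -> compact D -> exists2 C, 0 <= C & forall mu nu,
    finitely_supported D mu -> finitely_supported D nu ->
    (W2 lambda mu nu ^+ 2 <= C%:E)%E.
Proof.
move=> l0 cD.
have [C [C0 hC]] := compact_norm_bounded (V := R^o) (compact_setX cD cD)
  (@cost_continuous R d lambda).
exists C => // mu nu [I [w [x [mux Dx]]]] [J [v [y [nuy Dy]]]].
pose u (k : I * J) := w k.1 * v k.2.
have u0 k : 0 <= u k by rewrite mulr_ge0// ?mux.1// nuy.1.
have sumE (p : pred I) (q : pred J) : \sum_(k | p k.1 && q k.2) u k =
    (\sum_(i | p i) w i) * \sum_(j | q j) v j.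
  rewrite -(pair_big p q (fun i j => w i * v j))/= mulr_suml.
  by apply: eq_bigr => i _; rewrite mulr_sumr.
have mu_u : is_law mu u ((x \o fst) : _ -> borel (tokenT R d)).
  apply: (law_reindex (h := fst) mux) => // i.
  rewrite (eq_bigl (fun k => (k.1 == i) && xpredT k.2)); last first.
    by move=> k; rewrite andbT.
  by rewrite (sumE (pred1 i) xpredT) big_pred1_eq (law_sum1 nuy) mulr1.
have nu_u : is_law nu u ((y \o snd) : _ -> borel (tokenT R d)).
  apply: (law_reindex (h := snd) nuy) => // j.
  by rewrite (sumE xpredT (pred1 j)) big_pred1_eq (law_sum1 mux) mul1r.
apply: (le_trans (W2_sqr_le l0 mu_u nu_u)); rewrite lee_fin.
rewrite -[leRHS]mul1r -(law_sum1 mu_u) mulr_suml; apply: ler_sum => k _.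
rewrite ler_wpM2l// (le_trans (ler_norm _))//.
by apply: (hC (x k.1, y k.2)); split; [exact: Dx|exact: Dy].
Qed.

(** * Approximation of the controlled dynamics *)

Section approximation.
Context (R : realType) (N d d1 d2 : nat) (beta lambda : R).
Context (sigma : 'cV[R]_d1 -> 'cV[R]_d1).
Hypotheses (csigma : continuous sigma) (lambda_gt0 : 0 < lambda).
Local Notation token := (tokenT R d).
Local Notation param := (paramT R d d1 d2).
Local Notation P := (probability (borel token) R).
Variables (S : set 'cV[R]_d) (UU : set param).
Hypotheses (cS : compact S) (cUU : compact UU).
Hypothesis hlayer : forall z U (mu : P),
  tokens N S z -> UU U -> probs (tokens N S : set (borel token)) mu ->
  tokens N S (layer N beta sigma S z U mu).
Variable Sn : nat -> set 'cV[R]_d.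
Hypothesis hSn : forall n, (0 < n)%N ->
  [/\ finite_set (Sn n), Sn n `<=` S &
      forall s, S s -> exists2 s', Sn n s' & frob (s - s') < n%:R^-1].
Variable Q : nat -> 'cV[R]_d -> 'cV[R]_d.
Hypothesis hQ : forall n, (0 < n)%N -> nearest_point_map S (Sn n) (Q n).
Variable Rq : nat -> nat -> P -> P.
Hypothesis hRq : forall l n, (0 < l)%N -> (0 < n)%N ->
  measure_quantizer lambda l (tokens N (Sn n)) (Rq l n).

Local Notation X := (tokens N S).
Local Notation F := (Phi N beta sigma S).
Local Notation hatF l n :=
  (fun mu U => Rq l n (Phi_quantized N beta sigma S (Q n) mu U)).

Lemma finitely_supported_Phi (mu : P) U :
  finitely_supported X mu -> UU U -> finitely_supported X (F mu U).
Proof.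
move=> [I [w [x [mux Dx]]]] Uu; exists I, w.
exists (fun i => law_layer beta sigma (x i) U w (fun j => (x j).2)); split.
  exact: Phi_law.
by move=> i; apply: (law_layer_tokens cS hlayer mux) => //; exact: Dx.
Qed.

(** The coupling of [mu] and [mu'] is pushed through both steps with its index set and weights, then
    the layer modulus is averaged. The second conclusion lets the measure quantizer be applied
    next. *)
Lemma Phi_quantized_close e : 0 < e -> exists2 delta, 0 < delta &
  forall n U U' (mu mu' : P), (0 < n)%N -> UU U -> UU U' ->
    `|U - U'| <= delta -> close X mu mu' delta ->
    close X (F mu U) (Phi_quantized N beta sigma S (Q n) mu' U') (e + n%:R^-1)
    /\ probs (tokens N (Sn n) : set (borel token))
         (Phi_quantized N beta sigma S (Q n) mu' U').
Proof.
move=> e0; have e20 : 0 < e / 2 by rewrite divr_gt0.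
have [L [L0 hL]] := law_layer_almost_lipschitz beta csigma cS cUU e20.
have L10 : 0 < L + 1 by rewrite ltr_wpDl.
(* Three terms of size [L * delta] occur: the parameters, the laws, and the averaged distance of the
   moved atoms. Together they take up the remaining [e / 2]. *)
pose delta := e / 6 / (L + 1).
have delta0 : 0 < delta by rewrite !divr_gt0.
have Ldelta : L * delta <= e / 6.
  by rewrite /delta mulrA ler_pdivrMr// mulrC ler_wpM2l ?lerDl// ltW// divr_gt0.
exists delta => // n U U' mu mu' n0 Uu Uu' UU' [I [w [x [y [mux muy Dx Dy xy]]]]].
have [fSn SnS _] := hSn n0.
have w0 := mux.1; have w1 := law_sum1 mux.
pose f i := law_layer beta sigma (x i) U w (fun j => (x j).2).
pose g i := law_layer beta sigma (y i) U' w (fun j => (y j).2).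
have Df i : X (f i) by apply: (law_layer_tokens cS hlayer mux).
have Dg i : X (g i) by apply: (law_layer_tokens cS hlayer muy).
have hf : is_law (F mu U) w (f : I -> borel token) by exact: Phi_law.
have hg : is_law (Phi_quantized N beta sigma S (Q n) mu' U') w
    ((fun i => quantize (Q n) (g i)) : I -> borel token).
  exact: (Phi_quantized_law csigma cS hlayer fSn (hQ n0) muy).
have Dq i : tokens N (Sn n) (quantize (Q n) (g i)).
  exact: (quantize_tokens hQ n0 (Dg i)).
split; last first.
  by apply: (law_full hg) => //; apply: borel_finite; exact: tokens_finite.
exists I, w, f, (fun i => quantize (Q n) (g i)); split=> // [i|].
  exact: (tokens_sub SnS (Dq i)).
have fg i : `|f i - quantize (Q n) (g i)| <=
    (e / 2 + n%:R^-1 + L * (delta + delta)) + L * `|x i - y i|.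
  have Sx j : S (x j).2 by have [] := Dx j.
  have Sy j : S (y j).2 by have [] := Dy j.
  have h1 := hL U U' (x i) (y i) I w x y Uu Uu' (Sx i) (Sy i) w0 w1 Sx Sy.
  have h2 := quantize_dist hSn hQ n0 (Dg i).
  rewrite (le_trans (ler_distD (g i) _ _))//.
  rewrite (le_trans (lerD h1 h2))//.
  have : L * (`|U - U'| + `|x i - y i| + \sum_j w j * `|x j - y j|) <=
      L * (delta + delta) + L * `|x i - y i|.
    by rewrite -mulrDr ler_wpM2l// addrAC lerD2r lerD.
  by lra.
rewrite (@le_trans _ _ (\sum_i w i *
    ((e / 2 + n%:R^-1 + L * (delta + delta)) + L * `|x i - y i|)))//.
  by apply: ler_sum => i _; rewrite ler_wpM2l.
under eq_bigr do rewrite mulrDr (mulrCA (w _) L).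
rewrite big_split/= -mulr_suml w1 mul1r -mulr_sumr.
have : L * (\sum_i w i * `|x i - y i|) <= L * delta by rewrite ler_wpM2l.
by rewrite mulrDr; lra.
Qed.

Lemma inv_nat_le (e : R) : 0 < e ->
  exists n0, forall n, (n0 <= n)%N -> (0 < n)%N -> n%:R^-1 <= e.
Proof.
move=> e0; exists (Num.truncn e^-1).+1 => n n0n n0.
rewrite -[e]invrK lef_pV2 ?posrE ?invr_gt0 ?ltr0n//.
have /andP[_ /ltW h] := truncn_itv (ltW (divr_gt0 ltr01 e0)).
by rewrite div1r in h; rewrite (le_trans h)// ler_nat.
Qed.

Lemma hat_step_close e : 0 < e -> exists2 delta, 0 < delta & exists n0,
  forall l n U U' (mu mu' : P), (n0 <= l)%N -> (n0 <= n)%N ->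
    (0 < l)%N -> (0 < n)%N -> UU U -> UU U' ->
    `|U - U'| <= delta -> close X mu mu' delta ->
    close X (F mu U) (hatF l n mu' U') e.
Proof.
move=> e0; have e30 : 0 < e / 3 by rewrite divr_gt0.
have [delta delta0 hdelta] := Phi_quantized_close e30.
have [n1 hn1] := inv_nat_le e30.
have [l0 hl0] := measure_quantizer_close lambda_gt0 hSn hQ cS hRq e30.
exists delta => //; exists (maxn l0 n1) => l n U U' mu mu'.
rewrite !geq_max => /andP[l0l _] /andP[_ n1n] l_gt0 n_gt0 Uu Uu' UU' mumu'.
have [c1 pSn] := hdelta n U U' mu mu' n_gt0 Uu Uu' UU' mumu'.
have c2 := hl0 l n _ l0l l_gt0 n_gt0 pSn.
apply: coupled_le (close_trans c1 c2).
by have := hn1 n n1n n_gt0; lra.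
Qed.

Lemma quantized_data_close e : 0 < e -> exists n0,
  forall l n (mu : P), (n0 <= l)%N -> (n0 <= n)%N -> (0 < l)%N -> (0 < n)%N ->
    finitely_supported X mu ->
    close X mu (Rq l n (quantized_law N S (Q n) mu)) e.
Proof.
move=> e0; have e20 : 0 < e / 2 by rewrite divr_gt0.
have [n1 hn1] := inv_nat_le e20.
have [l0 hl0] := measure_quantizer_close lambda_gt0 hSn hQ cS hRq e20.
exists (maxn l0 n1) => l n mu.
rewrite !geq_max => /andP[l0l _] /andP[_ n1n] l_gt0 n_gt0 [I [w [x [mux Dx]]]].
have [fSn SnS _] := hSn n_gt0.
have hq : is_law (quantized_law N S (Q n) mu) w
    ((fun i => quantize (Q n) (x i)) : I -> borel token).
  exact: (law_push mux (borel_tokens N cS)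
    (measurable_quantize cS fSn (hQ n_gt0)) Dx).
have Dq i : tokens N (Sn n) (quantize (Q n) (x i)).
  exact: (quantize_tokens hQ n_gt0 (Dx i)).
have pSn : probs (tokens N (Sn n) : set (borel token))
    (quantized_law N S (Q n) mu).
  by apply: (law_full hq) => //; apply: borel_finite; exact: tokens_finite.
have c1 : close X mu (quantized_law N S (Q n) mu) (e / 2).
  exists I, w, x, (fun i => quantize (Q n) (x i)); split=> // [i|].
    exact: (tokens_sub SnS (Dq i)).
  rewrite (@le_trans _ _ (\sum_i w i * (e / 2)))//; last first.
    by rewrite -mulr_suml (law_sum1 mux) mul1r.
  apply: ler_sum => i _; rewrite ler_wpM2l ?mux.1//.
  rewrite (le_trans _ (hn1 n n1n n_gt0))//.
  exact: (quantize_dist hSn hQ n_gt0 (Dx i)).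
have := close_trans c1 (hl0 l n _ l0l l_gt0 n_gt0 pSn).
by rewrite -splitr.
Qed.

Variable K : nat.

(** The tolerance is chosen backwards in time: the accuracy that the last step demands of its input
    is the [e] of the induction hypothesis. Neither [delta] nor [n0] depends on the controls. *)
Lemma open_loop_close (mu0 : 'I_K -> P) (t : nat) e :
  (forall k, finitely_supported X (mu0 k)) ->
  0 < e -> exists2 delta, 0 < delta & exists n0,
  forall l n (U U' : nat -> param), (n0 <= l)%N -> (n0 <= n)%N ->
    (0 < l)%N -> (0 < n)%N -> control_seq t UU U -> control_seq t UU U' ->
    (forall s, (s < t)%N -> `|U s - U' s| <= delta) ->
    forall k, close X (open_loop F U mu0 t k)
      (open_loop (hatF l n) U'
        (fun k => Rq l n (quantized_law N S (Q n) (mu0 k))) t k) e.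
Proof.
move=> fmu0; elim: t e => [|t IH] e e0.
  have [n0 hn0] := quantized_data_close e0.
  by exists 1 => //; exists n0 => l n U U' l0 n0' l_gt0 n_gt0 _ _ _ k; exact: hn0.
have [delta delta0 [n0 hn0]] := hat_step_close e0.
have [delta' delta'0 [n1 hn1]] := IH _ delta0.
exists (Num.min delta delta'); first by rewrite lt_min delta0.
exists (maxn n0 n1) => l n U U'; rewrite !geq_max.
move=> /andP[n0l n1l] /andP[n0n n1n] l_gt0 n_gt0 Uu Uu' UU' k.
rewrite /open_loop /=; apply: hn0 => //.
- exact: Uu.
- exact: Uu'.
- by have := UU' t (ltnSn t); rewrite le_min => /andP[].
- apply: hn1 => //.
  + by move=> s st; apply: Uu; exact: ltnW.
  + by move=> s st; apply: Uu'; exact: ltnW.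
  + by move=> s st; have := UU' s (ltnW st); rewrite le_min => /andP[].
Qed.

Lemma open_loop_finitely_supported (mu0 : 'I_K -> P) (t : nat) U :
  (forall k, finitely_supported X (mu0 k)) -> control_seq t UU U ->
  forall k, finitely_supported X (open_loop F U mu0 t k).
Proof.
move=> fmu0; elim: t => [//|t IH] Uu k.
apply: finitely_supported_Phi; last exact: Uu.
by apply: IH => s st; apply: Uu; exact: ltnW.
Qed.

Lemma policy_open_loop (mu0 : 'I_K -> P) (T : nat) gamma :
  (forall k, finitely_supported X (mu0 k)) ->
  markov_policy T X UU gamma ->
  exists2 U, control_seq T UU U & closed_loop F gamma mu0 T = open_loop F U mu0 T.
Proof.
move=> fmu0 hgamma.
pose U t := gamma t (closed_loop F gamma mu0 t).
have UE t : closed_loop F gamma mu0 t = open_loop F U mu0 t.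
  elim: t => [|t IH]; first exact: erefl.
  apply/funext => k; transitivity (F (closed_loop F gamma mu0 t k) (U t)).
    exact: erefl.
  by rewrite IH.
(* A policy takes values in [UU] only on laws carried by the token space, and the laws stay there
   only under admissible controls; the induction on time resolves this mutual dependence. *)
have Uu t : (t <= T)%N -> control_seq t UU U.
  elim: t => [//|t IH tT] s; rewrite ltnS leq_eqVlt => /orP[/eqP ->|]; last first.
    by apply: IH; exact: ltnW.
  have [_ ] := hgamma t tT; apply => k.
  have [I [w [x [mux Dx]]]] :
      finitely_supported X (closed_loop F gamma mu0 t k).
    by rewrite UE; apply: open_loop_finitely_supported => //; exact/IH/ltnW.
  exact: (law_full mux (borel_tokens N cS) Dx).
by exists U => //; exact: Uu.
Qed.

End approximation.

(** * Near-optimality of the controls of the quantized problem *)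

Theorem theorem11 (R : realType) (N K d d1 d2 T : nat)
    (hN : (0 < N)%N) (hK : (0 < K)%N) (hd : (0 < d)%N)
    (hd1 : (0 < d1)%N) (hd2 : (0 < d2)%N) (hT : (0 < T)%N)
    (beta lambda : R) (hbeta : 0 < beta) (hlambda : 0 < lambda)
    (S : set 'cV[R]_d) (hS0 : S !=set0)
    (sigma : 'cV[R]_d1 -> 'cV[R]_d1) (hsigma : continuous sigma)
    (UU : set (paramT R d d1 d2)) (hUU0 : UU !=set0)
    (hlayer : forall z U (mu : probability (borel (tokenT R d)) R),
       tokens N S z -> UU U -> probs (tokens N S : set (borel (tokenT R d))) mu ->
       tokens N S (layer N beta sigma S z U mu))
    (x y : 'I_K -> 'I_N -> 'cV[R]_d)
    (hx : forall k i, S (x k i)) (hy : forall k i, S (y k i))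
    (* state quantization *)
    (Sn : nat -> set 'cV[R]_d)
    (hSn : forall n, (0 < n)%N ->
       [/\ finite_set (Sn n), Sn n `<=` S &
           forall s, S s -> exists2 s', Sn n s' & frob (s - s') < n%:R^-1])
    (Q : nat -> 'cV[R]_d -> 'cV[R]_d)
    (hQ : forall n, (0 < n)%N -> nearest_point_map S (Sn n) (Q n))
    (* action quantization *)
    (Um : nat -> set (paramT R d d1 d2))
    (hUm : forall m, (0 < m)%N ->
       [/\ finite_set (Um m), Um m `<=` UU &
           forall U, UU U ->
             exists2 U', Um m U' & param_norm (U' - U) <= m%:R^-1])
    (* measure quantization *)
    (Rq : nat -> nat -> probability (borel (tokenT R d)) R ->
          probability (borel (tokenT R d)) R)
    (hRq : forall l n, (0 < l)%N -> (0 < n)%N ->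
       measure_quantizer lambda l (tokens N (Sn n)) (Rq l n))
    (ell : nat -> nat)
    (hell0 : forall n, (0 < n)%N -> (0 < ell n)%N)
    (hell : (fun n => (ell n)%:R : R^o) =O_\oo (fun n => n%:R ^+ d.+1 : R^o))
    (hS : compact S) (hUU : compact UU)
    (hlambda_diam : N%:R / 2 * diam2 S ^+ 2 < lambda) :
  let data (z : 'I_K -> 'I_N -> 'cV[R]_d) (k : 'I_K) :
      probability (borel (tokenT R d)) R :=
    empirical (fun i => (position R i, z k i) : borel (tokenT R d)) in
  let mu0 := data x in
  let nu := data y in
  let F := Phi N beta sigma S in
  let V gamma := terminal_cost lambda nu (closed_loop F gamma mu0 T) in
  let V_open U := terminal_cost lambda nu (open_loop F U mu0 T) in
  let Gamma := markov_policy T (tokens N S) UU in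
  let hat_data l n z k := Rq l n (quantized_law N S (Q n) (data z k)) in
  let hat_F l n mu U := Rq l n (Phi_quantized N beta sigma S (Q n) mu U) in
  let hat_V l n U :=
    terminal_cost lambda (hat_data l n y)
      (open_loop (hat_F l n) U (hat_data l n x) T) in
  exists eps : nat -> nat -> nat -> R,
    [/\ forall l n m, 0 <= eps l n m,
        eps z.1.1 z.1.2 z.2 @[z --> filter_prod (filter_prod \oo \oo) \oo]
          --> (0 : R),
        ell n @[n --> \oo] --> \oo ->
          eps (ell z.1) z.1 z.2 @[z --> filter_prod \oo \oo] --> (0 : R) &
        forall l n m, (0 < l)%N -> (0 < n)%N -> (0 < m)%N ->
        forall U, optimal_control T (Um m) (hat_V l n) U ->
          (V_open U <= ereal_inf [set V gamma | gamma in Gamma]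
                       + (eps l n m)%:E)%E].
Proof.
move=> data mu0 nu F V V_open Gamma hat_data hat_F hat_V.
have cX : compact (tokens N S) by exact: tokens_compact.
have fs_data z k : (forall k i, S (z k i)) ->
    finitely_supported (tokens N S) (data z k).
  move=> Sz; exists 'I_N, (fun=> N%:R^-1), (fun i => (position R i, z k i)).
  split; first exact: law_empirical.
  by move=> i; split => //=; exists i.
have fs_mu0 k : finitely_supported (tokens N S) (mu0 k) by exact: fs_data.
have fs_nu k : finitely_supported (tokens N S) (nu k) by exact: fs_data.
have fs_open U : control_seq T UU U -> forall k,
    finitely_supported (tokens N S) (open_loop F U mu0 T k).
  by move=> Uu k; exact: (open_loop_finitely_supported hsigma hS hlayer).
have Um_UU m U : (0 < m)%N -> control_seq T (Um m) U -> control_seq T UU U.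
  by move=> m0 Uu t tT; have [_ UmU _] := hUm _ m0; apply: UmU; exact: Uu.
set infV := ereal_inf _.
have infV0 : (0 <= infV)%E.
  by apply: le_ereal_inf_tmp => _ [gamma _ <-]; exact: terminal_cost_ge0.
pose good l n m e := (0 < l)%N -> (0 < n)%N -> (0 < m)%N ->
  forall U, optimal_control T (Um m) (hat_V l n) U ->
    (V_open U <= infV + e%:E)%E.
apply: (@exists_vanishing_error R good ell).
(* A crude admissible error for every index: the true cost is at most [C], and the infimum is
   nonnegative. *)
- move=> l n m; have [C C0 hC] := W2_sqr_bounded hlambda cX.
  exists C => // l0 n0 m0 U [Uu _].
  apply: (@le_trans _ _ C%:E); last by rewrite leeDr.
  apply: terminal_cost_bounded => // k; apply: hC => //.
  exact/fs_open/(Um_UU m).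
- move=> l n m e h l0 n0 m0 U Uopt; apply/lee_addgt0Pr => e' e'0.
  by rewrite -addeA -EFinD; exact: h.
- move=> l n m e e' ee' h l0 n0 m0 U Uopt.
  by apply: (le_trans (h l0 n0 m0 U Uopt)); rewrite leeD2l// lee_fin.
move=> eta eta0; have eta20 : 0 < eta / 2 by rewrite divr_gt0.
have [delta delta0 hdelta] := W2_close hlambda cX eta20.
have [delta' delta'0 [n1 hn1]] := open_loop_close hsigma hlambda hS hUU hlayer
  hSn hQ hRq T fs_mu0 delta0.
have [n2 hn2] := quantized_data_close hlambda hS hSn hQ hRq delta0.
have [n3 hn3] := inv_nat_le delta'0.
exists (maxn n1 (maxn n2 n3)) => l n m; rewrite !geq_max.
move=> /and3P[n1l n2l _] /and3P[n1n n2n _] /and3P[_ _ n3m] l0 n0 m0 U [Uu Uopt].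
have close_nu k : close (tokens N S) (nu k) (hat_data l n y k) delta.
  exact: hn2.
have close_mu W W' : control_seq T UU W -> control_seq T UU W' ->
    (forall s, (s < T)%N -> `|W s - W' s| <= delta') -> forall k,
    close (tokens N S) (open_loop F W mu0 T k)
      (open_loop (hat_F l n) W' (hat_data l n x) T k) delta.
  by move=> Wu W'u WW' k; exact: hn1.
(* One half pays for passing from the true to the quantized cost of [U], the other for passing back
   at a competitor. Optimality of [U] is used in between. *)
apply: (@le_trans _ _ (infV + (eta / 2 + eta / 2)%:E)%E); last by rewrite -splitr.
rewrite EFinD addeA -leeBlDr// -leeBlDr//.
apply: le_ereal_inf_tmp => _ [gamma hgamma <-].
have [W Wu VW] := policy_open_loop hsigma hS hlayer fs_mu0 hgamma.
rewrite /V VW leeBlDr// leeBlDr//.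
(* The competitor [W'] rounds [W] to [Um m]; beyond the horizon its values are irrelevant, and [W t]
   serves as default witness. *)
have /choice[W' hW'] : forall t, exists U', (t < T)%N ->
    Um m U' /\ `|W t - U'| <= delta'.
  move=> t; have [tT|_] := boolP (t < T)%N; last by exists (W t).
  have [_ _ /(_ (W t) (Wu t tT))[U' Um' U'W]] := hUm _ m0.
  exists U' => _; split => //; rewrite distrC.
  by rewrite (le_trans (norm_le_param_norm _))// (le_trans U'W)// hn3.
have W'u : control_seq T (Um m) W' by move=> t tT; have [] := hW' t tT.
apply: (@le_trans _ _ (hat_V l n U + (eta / 2)%:E)%E).
  apply: terminal_cost_le => //; first exact: ltW.
  move=> k; apply: hdelta => //.
  apply: close_mu; [exact: Um_UU Uu|exact: Um_UU Uu|].
  by move=> s _; rewrite subrr normr0 ltW.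
rewrite leeD2r//; apply: (le_trans (Uopt _ W'u)).
apply: terminal_cost_le => //; first exact: ltW.
move=> k; apply: hdelta => //; apply: close_sym => //.
apply: close_mu => //; first exact: Um_UU W'u.
by move=> s sT; have [] := hW' s sT.
Qed.
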